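(* Let $G$ be a connected claw-free cubic graph. Then $Z(G)=\alpha(G)+1$ if and only if $G$ is isomorphic to one of the three graphs $C_3\,\Box\,K_2$, $N_2$, $N_3$.
   Context: All graphs are finite and simple. A graph is cubic if it is $3$-regular, and claw-free if it has no induced subgraph isomorphic to $K_{1,3}$. $\alpha(G)$ denotes the independence number of $G$. Zero forcing: start with a set $S\subseteq V(G)$ of colored vertices, all other vertices being uncolored. A colored vertex $v$ forces an uncolored neighbor $u$ to become colored if $u$ is the only uncolored neighbor of $v$. If iterating this rule colors all of $V(G)$, then $S$ is a zero forcing set. The zero forcing number $Z(G)$ is the minimum cardinality of a zero forcing set of $G$. $C_3\,\Box\,K_2$ is the Cartesian product of the triangle with $K_2$ (the triangular prism). For $m\ge 2$ the diamond necklace $N_m$ is the graph on the $4m$ vertices $a_k,b_k,c_k,d_k$ ($1\le k\le m$), in which for each $k$ the set $\{a_k,b_k,c_k,d_k\}$ induces a copy of $K_4$ minus the edge $\{a_k,b_k\}$, together with the edges $\{a_k,b_{k+1}\}$ for $1\le k\le m$, indices taken modulo $m$. *)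

(* Defs.v *)
From mathcomp Require Import all_boot.

Set Implicit Arguments.
Unset Strict Implicit.
Unset Printing Implicit Defensive.

Record sgraph := SGraph {
  vertex :> finType;
  adj : rel vertex;
  adj_sym : symmetric adj;
  adj_irrefl : irreflexive adj
}.

Notation "x -- y" := (adj x y) (at level 30, no associativity).

Definition isomorphic (G H : sgraph) : Prop :=
  exists f : G -> H, bijective f /\ forall x y : G, (f x -- f y) = (x -- y).

Definition connected (G : sgraph) : bool :=
  (0 < #|G|) && [forall x : G, forall y : G, connect (@adj G) x y].

Definition cubic (G : sgraph) : bool :=
  [forall x : G, #|[set y : G | x -- y]| == 3].

Section Induced.
Variables (G : sgraph) (S : {set G}).

Definition induced_adj : rel {x : G | x \in S} := fun x y => val x -- val y.

Lemma induced_sym : symmetric induced_adj.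
Proof. by move=> x y; apply: adj_sym. Qed.

Lemma induced_irrefl : irreflexive induced_adj.
Proof. by move=> x; apply: adj_irrefl. Qed.

Definition induced : sgraph := SGraph induced_sym induced_irrefl.
End Induced.

Section Complete.
Variable n : nat.

Definition complete_adj : rel 'I_n := fun x y => x != y.

Lemma complete_sym : symmetric complete_adj.
Proof. by move=> x y; rewrite /complete_adj eq_sym. Qed.

Lemma complete_irrefl : irreflexive complete_adj.
Proof. by move=> x; rewrite /complete_adj eqxx. Qed.

Definition complete_graph : sgraph := SGraph complete_sym complete_irrefl.
End Complete.

Section CompleteBipartite.
Variables m n : nat.

Definition bipartite_adj : rel ('I_m + 'I_n)%type := fun x y =>
  match x, y with
  | inl _, inr _ | inr _, inl _ => true
  | _, _ => false
  end.

Lemma bipartite_sym : symmetric bipartite_adj.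
Proof. by case=> x [] y. Qed.

Lemma bipartite_irrefl : irreflexive bipartite_adj.
Proof. by case. Qed.

Definition complete_bipartite : sgraph := SGraph bipartite_sym bipartite_irrefl.
End CompleteBipartite.

Definition claw_free (G : sgraph) : Prop :=
  forall S : {set G}, ~ isomorphic (induced S) (complete_bipartite 1 3).

Section CartesianProduct.
Variables G H : sgraph.

Definition cartesian_adj : rel (G * H)%type := fun x y =>
  (x.1 == y.1) && (x.2 -- y.2) || (x.2 == y.2) && (x.1 -- y.1).

Lemma cartesian_sym : symmetric cartesian_adj.
Proof.
move=> x y; rewrite /cartesian_adj (eq_sym x.1) (eq_sym x.2).
by rewrite (adj_sym x.1) (adj_sym x.2).
Qed.

Lemma cartesian_irrefl : irreflexive cartesian_adj.
Proof. by move=> x; rewrite /cartesian_adj !adj_irrefl !andbF. Qed.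

Definition cartesian_product : sgraph := SGraph cartesian_sym cartesian_irrefl.
End CartesianProduct.

Definition prism : sgraph :=
  cartesian_product (complete_graph 3) (complete_graph 2).

Section DiamondNecklace.
Variable m : nat.

(* (k, 0), (k, 1), (k, 2), (k, 3) stand for a_k, b_k, c_k, d_k, with k counted
   from 0; ordS is the successor modulo m.  The graph is meant for m >= 2. *)
Definition diamond_adj : rel 'I_4 := fun i j =>
  (i != j) && ~~ ((i < 2) && (j < 2)).

Definition necklace_link : rel ('I_m * 'I_4)%type := fun x y =>
  [&& val x.2 == 0, val y.2 == 1 & y.1 == ordS x.1].

Definition necklace_adj : rel ('I_m * 'I_4)%type := fun x y =>
  [|| (x.1 == y.1) && diamond_adj x.2 y.2,
      necklace_link x y | necklace_link y x].

Lemma necklace_sym : symmetric necklace_adj.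
Proof.
move=> x y; rewrite /necklace_adj /diamond_adj (eq_sym x.1) (eq_sym x.2).
by rewrite (andbC (x.2 < 2)) (orbC (necklace_link x y)).
Qed.

Lemma necklace_irrefl : irreflexive necklace_adj.
Proof.
move=> [k i]; rewrite /necklace_adj /diamond_adj /necklace_link /= !eqxx /=.
by case: (val i) => [|[|j]].
Qed.

Definition diamond_necklace : sgraph := SGraph necklace_sym necklace_irrefl.
End DiamondNecklace.

Section Invariants.
Variable G : sgraph.

Definition independent (A : {set G}) : bool :=
  [forall x in A, forall y in A, ~~ (x -- y)].

Definition independence_number : nat :=
  \max_(A : {set G} | independent A) #|A|.

Definition forces (S : {set G}) (v u : G) : bool :=
  [&& v \in S, u \notin S, v -- u &
      [forall w : G, (v -- w) && (w \notin S) ==> (w == u)]].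

Definition force_step : rel {set G} := fun A B =>
  [exists v : G, exists u : G, forces A v u && (B == u |: A)].

Definition zero_forcing (S : {set G}) : bool := connect force_step S setT.

Lemma zero_forcing_setT : zero_forcing setT.
Proof. exact: connect0. Qed.

(* The default setT of arg min is itself zero forcing (zero_forcing_setT), so
   this is the minimum over the zero forcing sets. *)
Definition zero_forcing_number : nat :=
  #|[arg min_(S < [set: G] | zero_forcing S) #|S| ]|.
End Invariants.

(* Main.v *)
Require Import Defs.
From mathcomp Require Import all_boot.
From Stdlib Require Import Lia.

(** Unless G is K4, it is partitioned into units: triangles that lie in no diamond, each
    sending out three edges, and diamonds, sending out two. Grow a set S unit by unit
    together with a set F that forces S and an independent set I inside S. A triangle
    reached by one edge costs one vertex of F and yields one of I; reached by two or three
    edges it costs nothing and still yields one. A diamond always costs one; it yields one,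
    or both tips when it is reached by two edges. Hence |I| - |F| rises by one whenever
    the new unit is reached by at least two edges, and otherwise does not change. The
    number of edges leaving S rises by at most one, and falls by at most three, exactly
    at such gains; since it must end at 0, enough gains occur unless G is tiny.
    Starting from a diamond (|I| - |F| = -2), at least two gains remain to be made as soon
    as S has four exits. The borderline cases (no gain before the last unit) are repaired
    by letting I contain vertices with edges out of S, and fail only for the necklaces
    N_2 and N_3. If there is no diamond, start from a triangle; then only the prism has
    too few gains. The three graphs and K4 are settled by computation. *)

Set Implicit Arguments.
Unset Strict Implicit.
Unset Printing Implicit Defensive.

(** * Zero forcing and independence *)

Section Forcing.
Variable G : sgraph.
Implicit Types (A B C F S I : {set G}) (u v w x y z : G).

Definition force_closed C := forall v u,
  v \in C -> v -- u -> (forall w, v -- w -> w != u -> w \in C) -> u \in C.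

(** Quantifying over closed supersets replaces a chronological list of forces: to show that [F]
    colours [S], one argues inside an arbitrary closed set, and derivations compose without tracking
    any order. *)
Definition derives F S := forall C, force_closed C -> F \subset C -> S \subset C.

Lemma force_step_sub C A B :
  force_closed C -> force_step A B -> A \subset C -> B \subset C.
Proof.
move=> clC /existsP[v /existsP[u /andP[/and4P[vA uA vu /forallP h] /eqP->]]] AC.
rewrite subUset AC andbT sub1set; apply: (clC v) => // [|w vw wu].
  exact: (subsetP AC).
apply: (subsetP AC); apply: contraNT wu => wA.
by have := h w; rewrite vw wA.
Qed.

Lemma force_step_incr A B : force_step A B -> A \subset B.
Proof. by case/existsP=> v /existsP[u /andP[_ /eqP->]]; apply: subsetUr. Qed.

(** For the converse, a set of maximal cardinality among those reachable from [F] admits no further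
    force, so it is closed and hence is everything. *)
Lemma zero_forcingP F : zero_forcing F <-> derives F setT.
Proof.
split=> [/connectP[s + ->] C clC|dF].
  elim: s F => [|B s IHs] A //= /andP[AB sP] AC.
  exact: IHs sP (force_step_sub clC AB AC).
have [A FA maxA] : exists2 A, connect (@force_step G) F A &
    forall B, connect (@force_step G) F B -> #|B| <= #|A|.
  by case: (arg_maxnP (fun B => #|B|) (connect0 (@force_step G) F)) => A; exists A.
have subFA : F \subset A.
  case/connectP: FA => s + ->; elim: s F {dF maxA} => [|B s IHs] F //=.
  by case/andP=> /force_step_incr FB /IHs; apply: subset_trans.
have clA : force_closed A.
  move=> v u vA vu h; apply/negPn/negP => uA.
  suff /maxA : connect (@force_step G) F (u |: A) by rewrite cardsU1 uA ltnn.
  apply: (connect_trans FA); apply: connect1; apply/existsP; exists v.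
  apply/existsP; exists u; rewrite eqxx andbT; apply/and4P; split=> //.
  apply/forallP=> w; apply/implyP=> /andP[vw]; apply: contraR => wu; exact: h.
have := dF A clA subFA; rewrite subTset => /eqP eA.
by rewrite /zero_forcing -eA.
Qed.

Lemma zero_forcing_number_le F :
  zero_forcing F -> zero_forcing_number G <= #|F|.
Proof.
rewrite /zero_forcing_number; case: arg_minnP => [|A _ minA]; last exact: minA.
exact: zero_forcing_setT.
Qed.

Lemma zero_forcing_number_attained :
  exists2 F : {set G}, zero_forcing F & #|F| = zero_forcing_number G.
Proof.
rewrite /zero_forcing_number; case: arg_minnP => [|A zA _]; last by exists A.
exact: zero_forcing_setT.
Qed.

Lemma independence_number_ge I : independent I -> #|I| <= independence_number G.
Proof. by move=> iI; apply: (leq_bigmax_cond (F := fun A : {set G} => #|A|)). Qed.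

Lemma independentP I :
  reflect {in I &, forall x y, ~~ x -- y} (independent I).
Proof.
apply: (iffP idP) => [/forall_inP h x y xI yI|h].
  by have /forall_inP := h x xI; apply.
by apply/forall_inP=> x xI; apply/forall_inP=> y yI; apply: h.
Qed.

Lemma independent_add I v :
  independent I -> (forall u, u \in I -> ~~ v -- u) -> independent (v |: I).
Proof.
move=> /independentP iI h; apply/independentP=> x y /setU1P[->|xI] /setU1P[->|yI].
- by rewrite adj_irrefl.
- exact: h.
- by rewrite adj_sym h.
- exact: iI.
Qed.
End Forcing.
(** * Explicit finite graphs *)

Section Presentations.

Lemma all_iota (P : pred nat) n i : all P (iota 0 n) -> i < n -> P i.
Proof. by move=> /allP h lti; apply: h; rewrite mem_iota. Qed.

(** Vertex sets become boolean masks so that quantification over all subsets can be run by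
    [vm_compute]. *)
Fixpoint forall_masks n (P : pred (seq bool)) : bool :=
  if n is n'.+1 then
    forall_masks n' (fun m => P (true :: m)) && forall_masks n' (fun m => P (false :: m))
  else P [::].

Lemma forall_masksP n (P : pred (seq bool)) m :
  forall_masks n P -> size m = n -> P m.
Proof.
elim: n P m => [|n IHn] P [|b m] //= /andP[Pt Pf] [sm].
by case: b; [apply: (IHn _ m Pt)|apply: (IHn _ m Pf)].
Qed.

Variable t : seq (seq nat).
Local Notation n := (size t).
Local Notation nbr i := (nth [::] t i).

Definition forced (m : seq bool) i j :=
  all (fun k => (k == j) || nth false m k) (nbr i).

Definition closed_mask (m : seq bool) :=
  all (fun i => nth false m i ==>
    all (fun j => forced m i j ==> nth false m j) (nbr i)) (iota 0 n).

Definition independent_mask (m : seq bool) :=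
  all (fun i => nth false m i ==> all (fun j => ~~ nth false m j) (nbr i)) (iota 0 n).

Definition sub_mask (m1 m2 : seq bool) :=
  all (fun i => nth false m1 i ==> nth false m2 i) (iota 0 n).

Definition force_mask (m : seq bool) := mkseq (fun j => nth false m j ||
  has (fun i => [&& nth false m i, j \in nbr i & forced m i j]) (iota 0 n)) n.

(** No proof that the fuel suffices is needed: [forcing_number_check] tests that the result is
    closed and contains the initial mask. *)
Fixpoint force_closure fuel m :=
  if fuel is fuel'.+1 then
    if closed_mask m then m else force_closure fuel' (force_mask m)
  else m.

(* Conditionals rather than [==>], since vm_compute evaluates both sides of [==>]. *)
Definition forcing_number_check k (m0 : seq bool) :=
  [&& size m0 == n, count id m0 == k,
   forall_masks n (fun c =>
     if sub_mask m0 c then if closed_mask c then all id c else true else true) &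
   forall_masks n (fun m =>
     if count id m < k then
       let c := force_closure n m in
       [&& size c == n, closed_mask c, sub_mask m c & ~~ all id c]
     else true)].

Definition independence_number_check k (m0 : seq bool) :=
  [&& size m0 == n, count id m0 == k, independent_mask m0 &
   forall_masks n (fun m => if k < count id m then ~~ independent_mask m else true)].

(** The table [t] lists the neighbours of each index, and [p] numbers the vertices. Values of [p]
    beyond the size of [t] are arbitrary. *)
Definition presents (G : sgraph) (p : nat -> G) :=
  [/\ {in [pred i | i < n] &, injective p},
      forall x, exists2 i, i < n & p i = x,
      forall i j, i < n -> j < n -> (p i -- p j) = (j \in nbr i) &
      all (all (fun j => j < n)) t].

Section Masks.
Variables (G : sgraph) (p : nat -> G).
Hypothesis Gp : presents p.
Implicit Types (A C F I : {set G}) (m c : seq bool).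

Definition mask_of C := mkseq (fun i => p i \in C) n.
Definition set_of m := [set x | has (fun i => (p i == x) && nth false m i) (iota 0 n)].

Lemma nbr_lt i j : i < n -> j \in nbr i -> j < n.
Proof.
case: Gp => _ _ _ /allP h lti; have /allP := h _ (mem_nth [::] lti); exact.
Qed.

Lemma presentsP i v : i < n -> reflect (exists2 j, j \in nbr i & p j = v) (p i -- v).
Proof.
move=> lti; case: Gp => _ surj adjE _; apply: (iffP idP) => [|[j jt <-]].
  by case: (surj v) => j ltj <-; rewrite adjE // => jt; exists j.
by rewrite adjE // (nbr_lt lti jt).
Qed.

Lemma nth_mask_of C i : i < n -> nth false (mask_of C) i = (p i \in C).
Proof. by move=> lti; rewrite nth_mkseq. Qed.

Lemma set_ofK m : size m = n -> mask_of (set_of m) = m.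
Proof.
move=> sm; apply: (@eq_from_nth _ false); rewrite size_mkseq // => i lti.
rewrite nth_mkseq // inE; case: Gp => inj _ _ _.
apply/hasP/idP => [[j] | mi]; last by exists i; rewrite ?mem_iota ?eqxx.
by rewrite mem_iota => ltj /andP[/eqP /inj <-].
Qed.

Lemma card_mask C : #|C| = count id (mask_of C).
Proof.
case: Gp => inj surj _ _; rewrite cardE /mask_of /mkseq count_map -size_filter.
rewrite -(size_map p); apply/perm_size/uniq_perm; first exact: enum_uniq.
  rewrite map_inj_in_uniq ?filter_uniq ?iota_uniq // => i j.
  rewrite !mem_filter !mem_iota => /andP[_ lti] /andP[_ ltj]; exact: inj.
move=> x; rewrite mem_enum; apply/idP/mapP => [xC|[i]].
  by case: (surj x) => i lti ix; exists i; rewrite // mem_filter mem_iota /= ix xC.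
by rewrite mem_filter /= => /andP[iC _] ->.
Qed.

Lemma force_closedP C : force_closed C <-> closed_mask (mask_of C).
Proof.
case: Gp => inj surj adjE _; split=> [clC|/allP h v u].
  apply/allP=> i; rewrite mem_iota /= => lti; apply/implyP.
  rewrite nth_mask_of // => iC; apply/allP=> j jt; apply/implyP=> /allP h.
  have ltj := nbr_lt lti jt; rewrite nth_mask_of //.
  apply: (clC (p i)) => //; first by apply/presentsP => //; exists j.
  move=> w /(presentsP _ lti)[k kt <-] kj; have := h k kt.
  by rewrite nth_mask_of ?(nbr_lt lti kt) // => /orP[/eqP ek|//]; rewrite ek eqxx in kj.
case: (surj v) => i lti <- iC /(presentsP _ lti)[j jt <-] hC.
have ltj := nbr_lt lti jt.
have := h i; rewrite mem_iota nth_mask_of // iC => /(_ lti)/allP/(_ j jt).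
rewrite nth_mask_of // => /implyP; apply; apply/allP=> k kt.
have ltk := nbr_lt lti kt; rewrite nth_mask_of //.
case: eqVneq => //= kj; apply: hC; first by apply/presentsP => //; exists k.
by apply: contra kj => /eqP/inj->.
Qed.

Lemma independent_maskP I : independent I = independent_mask (mask_of I).
Proof.
case: Gp => inj surj adjE _; apply/independentP/allP => [iI i|h x y].
  rewrite mem_iota => lti; apply/implyP; rewrite nth_mask_of // => iI'.
  apply/allP=> j jt; have ltj := nbr_lt lti jt; rewrite nth_mask_of //.
  by apply/negP => jI; have := iI _ _ iI' jI; rewrite adjE // jt.
case: (surj x) => i lti <-; case: (surj y) => j ltj <- iI jI.
apply/negP; rewrite adjE // => jt; have := h i; rewrite mem_iota nth_mask_of // iI.
by move=> /(_ lti)/allP/(_ j jt); rewrite nth_mask_of // jI.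
Qed.

Lemma sub_maskP A C : (A \subset C) = sub_mask (mask_of A) (mask_of C).
Proof.
case: Gp => _ surj _ _; apply/subsetP/allP => [AC i|h x].
  by rewrite mem_iota => lti; rewrite !nth_mask_of //; apply/implyP/AC.
case: (surj x) => i lti <-; have := h i; rewrite mem_iota !nth_mask_of //.
by move/(_ lti)/implyP.
Qed.

Lemma setT_maskP C : (C == setT) = all id (mask_of C).
Proof.
case: Gp => _ surj _ _; rewrite -subTset /mask_of all_map.
apply/subsetP/allP => [h i _|h x _]; first exact: h.
by case: (surj x) => i lti <-; apply: h; rewrite mem_iota.
Qed.

(** Upper bound: every closed mask containing [m0] is full. Lower bound: a set with fewer than [k]
    elements lies in a closed mask that is not full, so it cannot force the whole graph. *)
Lemma zero_forcing_number_presents k m0 :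
  forcing_number_check k m0 -> zero_forcing_number G = k.
Proof.
case/and4P=> /eqP sm0 /eqP cm0 up lo; apply/eqP; rewrite eqn_leq; apply/andP; split.
  rewrite -cm0 -(set_ofK sm0) -card_mask; apply: zero_forcing_number_le.
  apply/zero_forcingP=> C /force_closedP clC; rewrite sub_maskP subTset setT_maskP.
  rewrite set_ofK // => subC; have := forall_masksP up (size_mkseq _ _).
  by move/(_ (fun i => p i \in C)); rewrite -/(mask_of C) subC clC.
case: (zero_forcing_number_attained G) => F /zero_forcingP dF <-; rewrite leqNgt.
apply/negP; rewrite card_mask => ltF.
have := forall_masksP lo (size_mkseq (fun i => p i \in F) n).
rewrite -/(mask_of F) ltF; set c := force_closure _ _ => /and4P[/eqP sc clc subF].
rewrite -(set_ofK sc) -setT_maskP -subTset => /negP; apply.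
by apply: dF; [apply/force_closedP|rewrite sub_maskP]; rewrite set_ofK.
Qed.

Lemma independence_number_presents k m0 :
  independence_number_check k m0 -> independence_number G = k.
Proof.
case/and4P=> /eqP sm0 /eqP cm0 im0 hi; apply/eqP; rewrite eqn_leq; apply/andP; split.
  apply/bigmax_leqP => I; rewrite independent_maskP => iI; rewrite card_mask.
  have := forall_masksP hi (size_mkseq (fun i => p i \in I) n).
  by rewrite -/(mask_of I) iI leqNgt; case: ltnP.
rewrite -cm0 -(set_ofK sm0) -card_mask; apply: independence_number_ge.
by rewrite independent_maskP set_ofK.
Qed.
End Masks.

(** The isomorphism sends a vertex to the vertex of [H] with the same index; [xchoose] inverts the
    two numberings. *)
Lemma presents_isomorphic (G H : sgraph) (p : nat -> G) (q : nat -> H) :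
  presents p -> presents q -> isomorphic G H.
Proof.
move=> [pinj psurj padj _] [qinj qsurj qadj _].
have pidx x : exists i : 'I_n, p i == x.
  by case: (psurj x) => i lti ix; exists (Ordinal lti); apply/eqP.
have qidx x : exists i : 'I_n, q i == x.
  by case: (qsurj x) => i lti ix; exists (Ordinal lti); apply/eqP.
exists (fun x => q (xchoose (pidx x))); split.
  exists (fun y => p (xchoose (qidx y))) => x.
    set i := xchoose (pidx x); set j := xchoose _.
    have /eqP := xchooseP (qidx (q i)); rewrite -/j => /qinj -> //; last exact: ltn_ord.
      by apply/eqP; apply: (xchooseP (pidx x)).
    exact: ltn_ord.
  set j := xchoose (qidx x); set i := xchoose _.
  have /eqP := xchooseP (pidx (p j)); rewrite -/i => /pinj -> //; last exact: ltn_ord.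
    by apply/eqP; apply: (xchooseP (qidx x)).
  exact: ltn_ord.
move=> x y; rewrite qadj ?ltn_ord // -padj ?ltn_ord //.
by rewrite (eqP (xchooseP (pidx x))) (eqP (xchooseP (pidx y))).
Qed.

Lemma isomorphic_presents (G H : sgraph) (q : nat -> H) :
  isomorphic G H -> presents q -> exists p : nat -> G, presents p.
Proof.
move=> [f [[g fK gK] fadj]] [inj surj adjE tlt]; exists (g \o q); split=> //.
- by move=> i j lti ltj /(can_inj gK); apply: inj.
- by move=> x; case: (surj (f x)) => i lti ix; exists i; rewrite //= ix.
- by move=> i j lti ltj; rewrite /= -fadj !gK adjE.
Qed.

(* Cubicity makes the listed edges all the edges at the listed vertices, and then
   connectedness makes these all the vertices. *)
Lemma cubic_presents (G : sgraph) (x0 : G) (s : seq G) :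
    connected G -> cubic G -> size s = n -> 0 < n ->
    all (fun r => [&& uniq r, size r == 3 & all (fun j => j < n) r]) t ->
    uniq s ->
    all (fun i => all (fun j => nth x0 s i -- nth x0 s j) (nbr i)) (iota 0 n) ->
  presents (nth x0 s).
Proof.
move=> /andP[_ /forallP Gconn] /forallP Gcubic sn n0 /allP tP us hom.
have inj : {in [pred i | i < n] &, injective (nth x0 s)}.
  by move=> i j; rewrite !inE -sn => lti ltj /eqP; rewrite nth_uniq // => /eqP.
have NE i : i < n -> [set y | nth x0 s i -- y] =i [seq nth x0 s j | j <- nbr i].
  move=> lti; have /and3P[ui /eqP si /allP ltt] := tP _ (mem_nth [::] lti).
  have umap : uniq [seq nth x0 s j | j <- nbr i].
    by rewrite map_inj_in_uniq // => j k jt kt; apply: inj; apply: ltt.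
  (* One inclusion is the list of edges that was checked; both sides have three elements, so they
     are equal. *)
  suff e : [set y in [seq nth x0 s j | j <- nbr i]] = [set y | nth x0 s i -- y].
    by move=> y; rewrite -e inE.
  apply/eqP; rewrite eqEcard (eqP (Gcubic _)); apply/andP; split.
    apply/subsetP=> y; rewrite inE => /mapP[j jt ->]; rewrite inE.
    exact: (allP (all_iota hom lti)).
  by rewrite cardsE (card_uniqP umap) size_map si.
split=> //.
- have stable x y : x \in s -> x -- y -> y \in s.
    move=> /(nthP x0)[i]; rewrite sn => lti <- xy; have := NE i lti y.
    rewrite inE xy => /esym/mapP[j jt ->].
    by have /and3P[_ _ /allP/(_ j jt)] := tP _ (mem_nth [::] lti); rewrite -sn => /mem_nth.
  move=> x; suff /(nthP x0)[i] : x \in s by rewrite sn; exists i.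
  have /forallP/(_ x)/connectP[r + ->] := Gconn (nth x0 s 0).
  have : nth x0 s 0 \in s by rewrite mem_nth // sn.
  by elim: r (nth x0 s 0) => //= y r IHr z zs /andP[/(stable _ _ zs)]; apply: IHr.
- move=> i j lti ltj; have := NE i lti (nth x0 s j); rewrite inE => ->.
  have /and3P[_ _ /allP ltt] := tP _ (mem_nth [::] lti).
  by apply/mapP/idP => [[k kt /inj ->]|jt] //; [apply: ltt|exists j].
- by apply/allP=> r /tP/and3P[].
Qed.
End Presentations.

(** * The complete graph K_4, the prism and the necklaces N_2 and N_3 *)

Definition K4_table : seq (seq nat) :=
  [:: [:: 1; 2; 3]; [:: 0; 2; 3]; [:: 0; 1; 3]; [:: 0; 1; 2]].

Definition prism_table : seq (seq nat) :=
  [:: [:: 1; 2; 3]; [:: 0; 2; 4]; [:: 0; 1; 5];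
      [:: 4; 5; 0]; [:: 3; 5; 1]; [:: 3; 4; 2]].

(** Vertex [(k, i)] of the necklace has index 4k + i, so the links join 4k to 4(k+1) + 1
    cyclically. *)
Definition N2_table : seq (seq nat) :=
  [:: [:: 2; 3; 5]; [:: 2; 3; 4]; [:: 0; 1; 3]; [:: 0; 1; 2];
      [:: 6; 7; 1]; [:: 6; 7; 0]; [:: 4; 5; 7]; [:: 4; 5; 6]].

Definition N3_table : seq (seq nat) :=
  [:: [:: 2; 3; 5]; [:: 2; 3; 8]; [:: 0; 1; 3]; [:: 0; 1; 2];
      [:: 6; 7; 9]; [:: 6; 7; 0]; [:: 4; 5; 7]; [:: 4; 5; 6];
      [:: 10; 11; 1]; [:: 10; 11; 4]; [:: 8; 9; 11]; [:: 8; 9; 10]].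

Lemma presents_enum (t : seq (seq nat)) (G : sgraph) (x0 : G) (s : seq G) :
    uniq s -> size s = size t -> (forall x : G, x \in s) ->
    all (fun i => all (fun j => (nth x0 s i -- nth x0 s j) == (j \in nth [::] t i))
      (iota 0 (size t))) (iota 0 (size t)) ->
    all (all (fun j => j < size t)) t ->
  presents t (nth x0 s).
Proof.
move=> us sn sG adjE tlt; split=> //.
- by move=> i j; rewrite !inE -sn => lti ltj /eqP; rewrite nth_uniq // => /eqP.
- by move=> x; have /(nthP x0)[i] := sG x; rewrite sn; exists i.
- move=> i j lti ltj; exact: (eqP (all_iota (all_iota adjE lti) ltj)).
Qed.

Definition prism_vertices : seq prism :=
  [seq (i, j) | j <- [:: @Ordinal 2 0 isT; @Ordinal 2 1 isT],
    i <- [:: @Ordinal 3 0 isT; @Ordinal 3 1 isT; @Ordinal 3 2 isT]].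

Lemma prism_presents : exists q : nat -> prism, presents prism_table q.
Proof.
exists (nth (Ordinal (isT : 0 < 3), Ordinal (isT : 0 < 2)) prism_vertices).
apply: presents_enum; try by vm_compute.
by move=> [[[|[|[|?]]] ?] [[|[|?]] ?]].
Qed.

Definition diamond_vertices m (ks : seq 'I_m) : seq (diamond_necklace m) :=
  [seq (k, i) | k <- ks,
    i <- [:: @Ordinal 4 0 isT; @Ordinal 4 1 isT; @Ordinal 4 2 isT; @Ordinal 4 3 isT]].

Lemma N2_presents : exists q : nat -> diamond_necklace 2, presents N2_table q.
Proof.
exists (nth (Ordinal (isT : 0 < 2), Ordinal (isT : 0 < 4))
  (diamond_vertices [:: @Ordinal 2 0 isT; @Ordinal 2 1 isT])).
apply: presents_enum; try by vm_compute.
by move=> [[[|[|?]] ?] [[|[|[|[|?]]]] ?]].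
Qed.

Lemma N3_presents : exists q : nat -> diamond_necklace 3, presents N3_table q.
Proof.
exists (nth (Ordinal (isT : 0 < 3), Ordinal (isT : 0 < 4))
  (diamond_vertices [:: @Ordinal 3 0 isT; @Ordinal 3 1 isT; @Ordinal 3 2 isT])).
apply: presents_enum; try by vm_compute.
by move=> [[[|[|[|?]]] ?] [[|[|[|[|?]]]] ?]].
Qed.

Definition bits n (s : seq nat) := mkseq (fun i => i \in s) n.

Lemma K4_numbers (G : sgraph) (p : nat -> G) : presents K4_table p ->
  zero_forcing_number G = 3 /\ independence_number G = 1.
Proof.
move=> Gp; split.
  by apply: (zero_forcing_number_presents Gp (m0 := bits 4 [:: 0; 1; 2])); vm_compute.
by apply: (independence_number_presents Gp (m0 := bits 4 [:: 0])); vm_compute.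
Qed.

Lemma prism_numbers (G : sgraph) (p : nat -> G) : presents prism_table p ->
  zero_forcing_number G = 3 /\ independence_number G = 2.
Proof.
move=> Gp; split.
  by apply: (zero_forcing_number_presents Gp (m0 := bits 6 [:: 0; 1; 2])); vm_compute.
by apply: (independence_number_presents Gp (m0 := bits 6 [:: 0; 4])); vm_compute.
Qed.

Lemma N2_numbers (G : sgraph) (p : nat -> G) : presents N2_table p ->
  zero_forcing_number G = 4 /\ independence_number G = 3.
Proof.
move=> Gp; split.
  by apply: (zero_forcing_number_presents Gp (m0 := bits 8 [:: 0; 2; 3; 6])); vm_compute.
by apply: (independence_number_presents Gp (m0 := bits 8 [:: 0; 1; 6])); vm_compute.
Qed.

Lemma N3_numbers (G : sgraph) (p : nat -> G) : presents N3_table p ->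
  zero_forcing_number G = 5 /\ independence_number G = 4.
Proof.
move=> Gp; split.
  by apply: (zero_forcing_number_presents Gp (m0 := bits 12 [:: 0; 2; 3; 6; 10])); vm_compute.
by apply: (independence_number_presents Gp (m0 := bits 12 [:: 0; 1; 6; 10])); vm_compute.
Qed.
(** * Triangles and diamonds *)

Section Structure.
Variable G : sgraph.
Hypotheses (Gcubic : cubic G) (Gclaw : claw_free G).
Implicit Types (S T U E X F I C : {set G}).
Implicit Types (a b c d p q u v w x y z : G).

Ltac split_andb :=
  repeat match goal with H : is_true (_ && _) |- _ => case/andP: H => ? ? end.

Ltac distinct := rewrite /= ?inE ?negb_or;
  repeat (apply/andP; split); by [ | assumption | rewrite eq_sym; assumption].

(** Distinctness of the three neighbours is not part of the definition: it follows from cubicity by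
    [nbrs_uniq]. *)
Definition nbrs v a b c := forall u, (v -- u) = (u \in [:: a; b; c]).

Lemma nbrs_uniq v a b c : nbrs v a b c -> uniq [:: a; b; c].
Proof.
move=> vN; apply/card_uniqP; rewrite [RHS]/= -(eqP (forallP Gcubic v)) cardsE.
by apply: eq_card => u; rewrite -vN.
Qed.

Lemma nbrsCA v a b c : nbrs v a b c -> nbrs v b a c.
Proof. by move=> vN u; rewrite vN !inE orbCA. Qed.

Lemma nbrsAC v a b c : nbrs v a b c -> nbrs v a c b.
Proof. by move=> vN u; rewrite vN !inE [(u == b) || _]orbC. Qed.

Lemma adj_neq v u : v -- u -> v != u.
Proof. by apply: contraTneq => ->; rewrite adj_irrefl. Qed.

Lemma nbrs1 v a : v -- a -> exists b c, nbrs v a b c.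
Proof.
move=> va; have : #|[set u | v -- u] :\ a| == 2.
  by have := eqP (forallP Gcubic v); rewrite (cardsD1 a) inE va add1n => -[->].
case/cards2P=> b [c [bc /setP e]]; exists b, c => u.
have := e u; rewrite !inE; case: eqVneq => [->|_ /=] //.
Qed.

Lemma nbrs2 v a b : v -- a -> v -- b -> a != b -> exists c, nbrs v a b c.
Proof.
move=> va; case/nbrs1: (va) => p [q vN]; rewrite vN !inE => /or3P[]/eqP->.
- by rewrite eqxx.
- by exists q.
- by exists p; apply: nbrsAC.
Qed.

Lemma nbrs3 v a b c :
  v -- a -> v -- b -> v -- c -> uniq [:: a; b; c] -> nbrs v a b c.
Proof.
move=> va vb vc; rewrite /= !inE negb_or => /andP[/andP[ab ac] /andP[bc _]].
case: (nbrs2 va vb ab) => z vN; have := vc; rewrite vN !inE.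
by rewrite eq_sym (negPf ac) eq_sym (negPf bc) => /eqP ->.
Qed.

Lemma nbrs_adj v a b c : nbrs v a b c -> [/\ v -- a, v -- b & v -- c].
Proof. by move=> vN; rewrite !vN !inE !eqxx !orbT. Qed.

(** Otherwise the set of [v] and its neighbours induces a claw, with [v] mapped to the centre.
    Injectivity and equal cardinalities make the map bijective. *)
Lemma nbrs_claw v a b c : nbrs v a b c -> [|| a -- b, a -- c | b -- c].
Proof.
move=> vN; have := nbrs_uniq vN; case: (nbrs_adj vN) => va vb vc.
rewrite /= !inE negb_or => /andP[/andP[ab ac] /andP[bc _]].
have [na nb nc] : [/\ v != a, v != b & v != c] by split; apply: adj_neq.
apply/negPn/negP; rewrite !negb_or => /and3P[nab nac nbc].
pose S := [set v; a; b; c].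
pose f (u : induced S) : complete_bipartite 1 3 :=
  if val u == v then inl ord0 else
  if val u == a then inr ord0 else
  if val u == b then inr (@Ordinal 3 1 isT) else inr (@Ordinal 3 2 isT).
apply: (Gclaw (S := S)); exists f.
have Sv (u : induced S) : [\/ val u = v, val u = a, val u = b | val u = c].
  case: u => u /=; rewrite !inE -!orbA => /or4P[]/eqP->;
    by [constructor 1|constructor 2|constructor 3|constructor 4].
have ba : (b == a) = false by rewrite eq_sym (negPf ab).
have ca : (c == a) = false by rewrite eq_sym (negPf ac).
have cb : (c == b) = false by rewrite eq_sym (negPf bc).
have av : (a == v) = false by rewrite eq_sym (negPf na).
have bv : (b == v) = false by rewrite eq_sym (negPf nb).
have cv : (c == v) = false by rewrite eq_sym (negPf nc).
split; last first.
  move=> u1 u2; change (bipartite_adj (f u1) (f u2) = (val u1 -- val u2)); rewrite /f.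
  have [av' bv' cv'] : [/\ a -- v, b -- v & c -- v] by rewrite ?(adj_sym _ v).
  have [ba' ca' cb'] : [/\ ~~ b -- a, ~~ c -- a & ~~ c -- b].
    by rewrite (adj_sym b) !(adj_sym c).
  case: (Sv u1) => e1; case: (Sv u2) => e2; rewrite e1 e2 ?adj_irrefl;
  rewrite ?va ?vb ?vc ?av' ?bv' ?cv' ?(negPf nab) ?(negPf nac) ?(negPf nbc);
  rewrite ?(negPf ba') ?(negPf ca') ?(negPf cb');
  by rewrite ?eqxx ?av ?bv ?cv ?ba ?ca ?cb.
apply: inj_card_bij.
  move=> u1 u2; rewrite /f; case: (Sv u1) => e1; case: (Sv u2) => e2;
  rewrite e1 e2 ?eqxx ?av ?bv ?cv ?ba ?ca ?cb => h; try discriminate h;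
  apply: val_inj; congruence.
rewrite card_sum !card_ord card_sig; apply: eq_leq; symmetry.
have /card_uniqP : uniq [:: v; a; b; c] by rewrite /= !inE !negb_or na nb nc ab ac bc.
rewrite [size _]/= => e4; transitivity 4 => //; rewrite -e4.
by apply: eq_card => u; rewrite !inE -!orbA.
Qed.

(** A triangle meeting [S] lies in [S]. This expresses locally that [S] is a union of units. *)
Definition tri_closed S := forall u v w,
  u -- v -> v -- w -> u -- w -> u \in S -> v \in S.

Definition exits S := [set y in S | [exists z, (z \notin S) && (y -- z)]].

Lemma exitP S y :
  reflect (y \in S /\ exists2 z, z \notin S & y -- z) (y \in exits S).
Proof.
rewrite inE; apply: (iffP andP) => [[yS /existsP[z /andP[]]]|[yS [z zS yz]]].
  by split=> //; exists z.
by split=> //; apply/existsP; exists z; rewrite zS.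
Qed.

Lemma exits_sub S y : y \in exits S -> y \in S.
Proof. by case/exitP. Qed.

Lemma tri_closedU S T : tri_closed S -> tri_closed T -> tri_closed (S :|: T).
Proof.
move=> cS cT u v w uv vw uw /setUP[/(cS _ _ _ uv vw uw)|/(cT _ _ _ uv vw uw)];
by rewrite inE => ->; rewrite ?orbT.
Qed.

(** Two of the three neighbours of [y] are adjacent by claw-freeness. If two neighbours were
    outside, that pair would contain one of them, and its triangle with [y] would pull it into [S].
    Hence counting exits is counting the edges leaving [S]. *)
Lemma exit_unique S y z z' : tri_closed S -> y \in S ->
  y -- z -> z \notin S -> y -- z' -> z' \notin S -> z' = z.
Proof.
move=> cS yS yz zS yz' z'S; apply/eqP; apply: contraT => zz'.
case: (nbrs2 yz' yz zz') => w yN; case: (nbrs_adj yN) => _ _ yw.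
case/or3P: (nbrs_claw yN) => e.
- by rewrite (cS _ _ _ yz' e yz yS) in z'S.
- by rewrite (cS _ _ _ yz' e yw yS) in z'S.
- by rewrite (cS _ _ _ yz e yw yS) in zS.
Qed.

(** The primed vertices are the outer neighbours; their distinctness keeps the triangle out of any
    diamond. *)
Definition triangle x p q x' p' q' :=
  [/\ nbrs x p q x', nbrs p x q p', nbrs q x p q' & uniq [:: x; p; q; x'; p'; q']].

(** The tips are [a] and [b], the central edge is [c -- d]. The outer neighbours [a'] and [b'] may
    coincide, but [a'] differs from [b], which excludes K_4. *)
Definition diamond a b c d a' b' :=
  [/\ nbrs a c d a', nbrs b c d b', nbrs c a b d, nbrs d a b c &
      uniq [:: a; b; c; d; a'] && uniq [:: a; b; c; d; b']].

Lemma triangle_swap x p q x' p' q' :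
  triangle x p q x' p' q' -> triangle x q p x' q' p'.
Proof.
case=> Nx Np Nq; rewrite /= !inE !negb_or => un; split_andb.
by split; [apply: nbrsCA|..|distinct].
Qed.

(** The edge from [x] to its outer neighbour lies in no triangle, so every triangle at [x] stays
    among [p] and [q]. *)
Lemma outer_edge x p q x' v w : nbrs x p q x' -> ~~ p -- x' -> ~~ q -- x' ->
  x -- v -> v -- w -> x -- w -> (v == p) || (v == q).
Proof.
move=> Nx px qx; rewrite !Nx !inE => /or3P[->|->|/eqP->]; rewrite ?orbT //.
by rewrite adj_sym => + /or3P[]/eqP e; rewrite e ?adj_irrefl ?(negPf px) ?(negPf qx).
Qed.

Ltac negs := repeat match goal with
  | H : is_true (?a != ?b) |- context [?a == ?b] => rewrite (negPf H)
  | H : is_true (?a != ?b) |- context [?b == ?a] => rewrite [b == a]eq_sym (negPf H)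
  end.

Lemma triangle_closed x p q x' p' q' :
  triangle x p q x' p' q' -> tri_closed [set x; p; q].
Proof.
case=> Nx Np Nq; rewrite /= !inE !negb_or => un; split_andb.
move=> u v w uv vw uw; rewrite !inE -!orbA.
case/or3P=> /eqP e; rewrite {u}e in uv uw.
- suff /orP[->|->] : (v == p) || (v == q) by rewrite ?orbT.
  apply: (outer_edge Nx _ _ uv vw uw); first by rewrite Np !inE; negs.
  by rewrite Nq !inE; negs.
- suff /orP[->|->] : (v == x) || (v == q) by rewrite ?orbT.
  apply: (outer_edge Np _ _ uv vw uw); first by rewrite Nx !inE; negs.
  by rewrite Nq !inE; negs.
- suff /orP[->|->] : (v == x) || (v == p) by rewrite ?orbT.
  apply: (outer_edge Nq _ _ uv vw uw); first by rewrite Nx !inE; negs.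
  by rewrite Np !inE; negs.
Qed.

Lemma diamond_closed a b c d a' b' :
  diamond a b c d a' b' -> tri_closed [set a; b; c; d].
Proof.
case=> Na Nb Nc Nd; rewrite /= !inE !negb_or => un; split_andb.
move=> u v w uv vw uw; rewrite !inE -!orbA.
case/or4P=> /eqP e; rewrite {u}e in uv uw.
- suff /orP[->|->] : (v == c) || (v == d) by rewrite ?orbT.
  apply: (outer_edge Na _ _ uv vw uw); first by rewrite Nc !inE; negs.
  by rewrite Nd !inE; negs.
- suff /orP[->|->] : (v == c) || (v == d) by rewrite ?orbT.
  apply: (outer_edge Nb _ _ uv vw uw); first by rewrite Nc !inE; negs.
  by rewrite Nd !inE; negs.
- by move: uv; rewrite Nc !inE => /or3P[]->; rewrite ?orbT.
- by move: uv; rewrite Nd !inE => /or3P[]->; rewrite ?orbT.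
Qed.

(* The digit is the number of edges between the new unit and S. *)
Inductive growth S y : {set G} -> Prop :=
| Tri1 x p q p' q' of triangle x p q y p' q' & [/\ x \notin S, p \notin S & q \notin S]
    & p' \notin S & q' \notin S : growth S y ([set x; p; q] :|: S)
| Tri2 x p q p' q' of triangle x p q y p' q' & [/\ x \notin S, p \notin S & q \notin S]
    & p' \in S & q' \notin S : growth S y ([set x; p; q] :|: S)
| Tri3 x p q p' q' of triangle x p q y p' q' & [/\ x \notin S, p \notin S & q \notin S]
    & p' \in S & q' \in S : growth S y ([set x; p; q] :|: S)
| Dia1 a b c d b' of diamond a b c d y b'
    & [/\ a \notin S, b \notin S, c \notin S & d \notin S]
    & b' \notin S : growth S y ([set a; b; c; d] :|: S)
| Dia2 a b c d b' of diamond a b c d y b'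
    & [/\ a \notin S, b \notin S, c \notin S & d \notin S]
    & b' \in S : growth S y ([set a; b; c; d] :|: S).

Lemma in_neq S u v : u \in S -> v \notin S -> u != v.
Proof. by move=> uS; apply: contraNneq => <-. Qed.

(** An exit leads to some [x] outside [S]. No triangle contains the edge from [y] to [x], so
    claw-freeness joins the other two neighbours [p], [q] of [x]. Comparing the third neighbours of
    [p] and [q] tells a diamond from a triangle. *)
Lemma growth_exists S y : tri_closed S -> y \in exits S -> exists T, growth S y T.
Proof.
move=> cS /exitP[yS [x xS yx]]; have xy : x -- y by rewrite adj_sym.
have out u v w : u -- v -> v -- w -> u -- w -> v \notin S -> u \notin S.
  by move=> uv vw uw; apply: contra; apply: cS vw uw.
case: (nbrs1 xy) => p [q xN]; have uN := nbrs_uniq xN.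
case: (nbrs_adj xN) => _ xp xq.
have yp : ~~ y -- p by apply: contra xS => yp; apply: cS yx xp yp yS.
have yq : ~~ y -- q by apply: contra xS => yq; apply: cS yx xq yq yS.
have pq : p -- q by have := nbrs_claw xN; rewrite (negPf yp) (negPf yq).
have px : p -- x by rewrite adj_sym.
have qx : q -- x by rewrite adj_sym.
have qp : q -- p by rewrite adj_sym.
have pS : p \notin S by apply: out px xq pq xS.
have qS : q \notin S by apply: out qx xp qp xS.
case: (nbrs2 px pq (adj_neq xq)) => p' pN.
case: (nbrs2 qx qp (adj_neq xp)) => q' qN.
have upN := nbrs_uniq pN; have uqN := nbrs_uniq qN.
case: (nbrs_adj pN) => _ _ pp'; case: (nbrs_adj qN) => _ _ qq'.
have npp' := adj_neq pp'; have nqq' := adj_neq qq'.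
have yx' := in_neq yS xS; have yp' := in_neq yS pS; have yq' := in_neq yS qS.
have npq := adj_neq pq.
move: uN upN uqN; rewrite /= !inE !negb_or => uN upN uqN; split_andb.
(* A common third neighbour [p'] makes [x] and [p'] the tips of a diamond with central edge
   [p -- q]. *)
have [e|p'q'] := eqVneq p' q'.
  subst q'; have p'p : p' -- p by rewrite adj_sym.
  have p'q : p' -- q by rewrite adj_sym.
  have p'S : p' \notin S by apply: out p'p pq p'q pS.
  have p'y := in_neq yS p'S.
  case: (nbrs2 p'p p'q npq) => z zN; have uzN := nbrs_uniq zN.
  case: (nbrs_adj zN) => _ _ /adj_neq p'z.
  have p'x : ~~ x -- p' by rewrite xN !inE; negs.
  have xz : x != z.
    apply: contraNneq p'x => ->; rewrite adj_sym.
    by case: (nbrs_adj zN).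
  move: uzN; rewrite /= !inE !negb_or => uzN; split_andb.
  have D : diamond x p' p q y z.
    split=> //; first by apply: nbrsAC; apply: nbrsCA.
    - exact: nbrsAC.
    - exact: nbrsAC.
    - by apply/andP; split; distinct.
  have [zS|zS] := boolP (z \in S); eexists; [apply: Dia2|apply: Dia1]; by [exact: D|].
have yp'' : y != p'.
  by apply: contraNneq yp => ->; rewrite adj_sym.
have yq'' : y != q'.
  by apply: contraNneq yq => ->; rewrite adj_sym.
have Tr : triangle x p q y p' q'.
  split=> //; first by apply: nbrsAC; apply: nbrsCA.
  distinct.
have Tr' := triangle_swap Tr.
have [p'S|p'S] := boolP (p' \in S); have [q'S|q'S] := boolP (q' \in S); eexists.
- exact: Tri3 Tr _ _ _.
- exact: Tri2 Tr _ _ _.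
- exact: Tri2 Tr' _ _ _.
- exact: Tri1 Tr _ _ _.
Qed.

(** Here [U] is the new unit, [E] the set of its entry points in [S], and [X] the set of its own
    exits. An entry point had only one edge leaving [S], which ends in [U], so it stops being an
    exit; other exits of [S] remain. The count is additive to avoid truncated subtraction. *)
Lemma exits_step S U E X : tri_closed S -> {in U, forall u, u \notin S} ->
    {in E, forall y, y \in S /\ exists2 u, u \in U & y -- u} ->
    {in U & S, forall u y, u -- y -> y \in E} ->
    {in X, forall u, u \in U /\ exists2 z, z \notin U :|: S & u -- z} ->
    (forall u z, u \in U -> z \notin U -> z \notin S -> u -- z -> u \in X) ->
  (forall v, (v \in exits (U :|: S)) = (v \in X) || (v \notin E) && (v \in exits S)) /\
  #|exits (U :|: S)| + #|E| = #|X| + #|exits S|.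
Proof.
move=> cS US hE1 hE2 hX1 hX2.
have memE v : (v \in exits (U :|: S)) = (v \in X :|: (exits S :\: E)).
  rewrite !in_setU in_setD; apply/idP/idP => [/exitP[/setUP[vU|vS] [z]]|].
  - by rewrite in_setU negb_or => /andP[zU zS] vz; rewrite (hX2 v z).
  - rewrite in_setU negb_or => /andP[zU zS] vz; apply/orP; right; apply/andP; split.
      apply: contra zU => /hE1[_ [u uU vu]].
      by rewrite (exit_unique cS vS vu (US _ uU) vz zS).
    by apply/exitP; split=> //; exists z.
  - case/orP=> [/hX1[vU [z zUS vz]]|/andP[vE /exitP[vS [z zS vz]]]]; apply/exitP.
      by split; [rewrite in_setU vU|exists z].
    split; first by rewrite in_setU vS orbT.
    exists z => //; rewrite in_setU negb_or zS andbT.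
    by apply: contra vE => zU; apply: (hE2 z) => //; rewrite adj_sym.
split=> [v|]; first by rewrite memE in_setU in_setD.
rewrite (eq_card memE) cardsU (_ : X :&: _ = set0) ?cards0 ?subn0; last first.
  apply/setP=> v; rewrite !inE; apply/negP => /andP[/hX1[/US vS _]].
  by rewrite (negPf vS) andbF.
rewrite cardsD (_ : _ :&: E = E) ?subnK -?addnA ?subnK //.
  apply: subset_leq_card; apply/subsetP=> y /hE1[yS [u uU yu]].
  by apply/exitP; split=> //; exists u; rewrite ?US.
apply/setIidPr/subsetP=> y /hE1[yS [u uU yu]].
by apply/exitP; split=> //; exists u; rewrite ?US.
Qed.

Lemma card_set3 a b c : uniq [:: a; b; c] -> #|[set a; b; c]| = 3.
Proof. by move/card_uniqP => /= <-; apply: eq_card => u; rewrite !inE orbA. Qed.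

(** * Growing by one unit *)

Lemma force_third C v a b c :
  force_closed C -> nbrs v a b c -> v \in C -> a \in C -> b \in C -> c \in C.
Proof.
move=> clC vN vC aC bC; apply: (clC v) => // [|w]; first by case: (nbrs_adj vN).
by rewrite vN !inE => /or3P[]/eqP-> //; rewrite eqxx.
Qed.

(** All other neighbours of [y] lie in [S] by [exit_unique], so [y] forces [x]. Thus crossing an
    edge out of a coloured set is free. *)
Lemma force_exit C S y x : force_closed C -> tri_closed S -> S \subset C ->
  y \in S -> x \notin S -> y -- x -> x \in C.
Proof.
move=> clC cS SC yS xS yx; apply: (clC y) => // [|w yw wx].
  exact: (subsetP SC).
apply/(subsetP SC)/negPn/negP => wS.
by rewrite (exit_unique cS yS yx xS yw wS) eqxx in wx.
Qed.

Ltac contra_mem := match goal with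
  | H : is_true (?u \in ?S), H' : is_true (?u \notin ?S) |- _ => by rewrite H in H'
  end.

Ltac unit_side := subst; rewrite ?inE ?eqxx ?orbT; by [|negs|contra_mem].

Ltac cases_in := rewrite ?inE -?orbA; repeat case/orP; move/eqP->.

(** Settles the bookkeeping of [exits_step] from the neighbour lists, leaving one goal per entry
    point (its neighbour in the unit) and one per new exit (its neighbour outside). For a triangle
    one list is repeated as the fourth argument. *)
Ltac step_exits N1 N2 N3 N4 :=
  apply: exits_step => //;
  [ by move=> ?; cases_in
  | move=> ?; cases_in; split=> //
  | move=> ? ?; cases_in => ?; rewrite ?N1 ?N2 ?N3 ?N4 !inE => /or3P[]/eqP ?; unit_side
  | first [by move=> ?; rewrite inE | move=> ?; cases_in]; split; rewrite ?inE ?eqxx ?orbT //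
  | move=> ? ?; cases_in => + ?; rewrite ?N1 ?N2 ?N3 ?N4 !inE => + /or3P[]/eqP ?; unit_side ].


Ltac entry u := exists u; rewrite ?inE ?eqxx ?orbT // adj_sym //.
Ltac leave z := exists z => //; rewrite !inE; negs.

Section TriangleStep.
Variables (S : {set G}) (y x p q p' q' : G).
Hypotheses (cS : tri_closed S) (yS : y \in S) (Txpq : triangle x p q y p' q').
Hypothesis xpqS : [/\ x \notin S, p \notin S & q \notin S].
Local Notation T := ([set x; p; q] :|: S).

Lemma tri1_exits : p' \notin S -> q' \notin S ->
  (forall v, (v \in exits T) = (v \in [set p; q]) || (v \notin [set y]) && (v \in exits S))
  /\ #|exits T| = #|exits S|.+1.
Proof.
move: Txpq xpqS => [xN pN qN un] [xS pS qS] p'S q'S.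
have [_ _ xy] := nbrs_adj xN; have [_ _ pp'] := nbrs_adj pN.
have [_ _ qq'] := nbrs_adj qN.
move: un; rewrite /= !inE !negb_or => un; split_andb.
suff [exE cE] : (forall v, (v \in exits T) = (v \in [set p; q]) || (v \notin [set y]) && (v \in exits S))
  /\ #|exits T| + #|[set y]| = #|[set p; q]| + #|exits S|.
  by split=> //; move: cE; rewrite cards1 cards2 (_ : p != q) // addn1 add2n => -[->].
step_exits xN pN qN xN.
- entry x.
- by leave p'.
- by leave q'.
Qed.

Lemma tri2_exits : p' \in S -> q' \notin S ->
  (forall v, (v \in exits T) = (v \in [set q]) || (v \notin [set y; p']) && (v \in exits S))
  /\ #|exits T|.+1 = #|exits S|.
Proof.
move: Txpq xpqS => [xN pN qN un] [xS pS qS] p'S q'S.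
have [_ _ xy] := nbrs_adj xN; have [_ _ pp'] := nbrs_adj pN.
have [_ _ qq'] := nbrs_adj qN.
move: un; rewrite /= !inE !negb_or => un; split_andb.
suff [exE cE] : (forall v, (v \in exits T) = (v \in [set q]) || (v \notin [set y; p']) && (v \in exits S))
  /\ #|exits T| + #|[set y; p']| = #|[set q]| + #|exits S|.
  by split=> //; move: cE; rewrite cards1 cards2 (_ : y != p') // addn2 add1n => -[->].
step_exits xN pN qN xN.
- entry x.
- entry p.
- by leave q'.
Qed.

Lemma tri3_exits : p' \in S -> q' \in S ->
  (forall v, (v \in exits T) = (v \in set0) || (v \notin [set y; p'; q']) && (v \in exits S))
  /\ #|exits T| + 3 = #|exits S|.
Proof.
move: Txpq xpqS => [xN pN qN un] [xS pS qS] p'S q'S.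
have [_ _ xy] := nbrs_adj xN; have [_ _ pp'] := nbrs_adj pN.
have [_ _ qq'] := nbrs_adj qN.
move: un; rewrite /= !inE !negb_or => un; split_andb.
suff [exE cE] : (forall v, (v \in exits T) = (v \in set0) || (v \notin [set y; p'; q']) && (v \in exits S))
  /\ #|exits T| + #|[set y; p'; q']| = #|(set0 : {set G})| + #|exits S|.
  by split=> //; move: cE; rewrite cards0 card_set3 //; distinct.
step_exits xN pN qN xN.
- entry x.
- entry p.
- entry q.
Qed.

Lemma triangle_forces F C : force_closed C -> S \subset C -> derives F S ->
  x \in C -> p \in C -> T \subset C.
Proof.
case: Txpq => xN _ _ _ clC SC _ xC pC.
have yC := subsetP SC _ yS; rewrite subUset SC andbT.
by apply/subsetP=> v; rewrite !inE -orbA => /or3P[]/eqP-> //;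
  apply: (force_third clC (nbrsAC xN)).
Qed.

(** The entry [y] forces [x], the vertex [p] is paid for, and then [x] forces [q]. *)
Lemma tri1_derives F : derives F S -> derives (p |: F) T.
Proof.
case: Txpq xpqS => xN _ _ _ [xS _ _] dF C clC.
rewrite subUset sub1set => /andP[pC FC]; have SC := dF C clC FC.
apply: (triangle_forces clC SC dF) => //; apply: (force_exit clC cS SC yS xS).
by rewrite adj_sym; case: (nbrs_adj xN).
Qed.

(** Two entries force [x] and [p], and [x] forces [q]. The position of [q'] is left open, so this
    serves three edges too. *)
Lemma tri2_derives F : p' \in S -> derives F S -> derives F T.
Proof.
case: Txpq xpqS => xN pN _ _ [xS pS _] p'S dF C clC FC; have SC := dF C clC FC.
apply: (triangle_forces clC SC dF).
  by apply: (force_exit clC cS SC yS xS); rewrite adj_sym; case: (nbrs_adj xN).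
by apply: (force_exit clC cS SC p'S pS); rewrite adj_sym; case: (nbrs_adj pN).
Qed.
End TriangleStep.

Section DiamondStep.
Variables (S : {set G}) (y a b c d b' : G).
Hypotheses (cS : tri_closed S) (yS : y \in S) (Dabcd : diamond a b c d y b').
Hypothesis abcdS : [/\ a \notin S, b \notin S, c \notin S & d \notin S].
Local Notation T := ([set a; b; c; d] :|: S).

Lemma dia1_exits : b' \notin S ->
  (forall v, (v \in exits T) = (v \in [set b]) || (v \notin [set y]) && (v \in exits S))
  /\ #|exits T| = #|exits S|.
Proof.
move: Dabcd abcdS => [aN bN cN dN un] [aS bS cS' dS] b'S.
have [_ _ ay] := nbrs_adj aN; have [_ _ bb'] := nbrs_adj bN.
move: un; rewrite /= !inE !negb_or => un; split_andb.
suff [exE cE] : (forall v, (v \in exits T) = (v \in [set b]) || (v \notin [set y]) && (v \in exits S))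
  /\ #|exits T| + #|[set y]| = #|[set b]| + #|exits S|.
  by split=> //; move: cE; rewrite !cards1 addn1 add1n => -[->].
step_exits aN bN cN dN.
- entry a.
- by leave b'.
Qed.

(** If both tips were entered from [y], then [y] would have two neighbours outside [S]. *)
Lemma dia2_entries : b' \in S -> y != b'.
Proof.
move: Dabcd abcdS => [aN bN cN dN un] [aS bS cS' dS] b'S.
have [_ _ ay] := nbrs_adj aN; have [_ _ bb'] := nbrs_adj bN.
move: un; rewrite /= !inE !negb_or => un; split_andb.
have ab : a != b by []; apply/eqP => e; subst b'; have := @exit_unique S y a b cS yS.
by rewrite ![y -- _]adj_sym => /(_ ay aS bb' bS) e; rewrite e eqxx in ab.
Qed.

Lemma dia2_exits : b' \in S ->
  (forall v, (v \in exits T) = (v \in set0) || (v \notin [set y; b']) && (v \in exits S))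
  /\ #|exits T| + 2 = #|exits S|.
Proof.
move=> b'S; have yb' := dia2_entries b'S.
move: Dabcd abcdS => [aN bN cN dN un] [aS bS cS' dS].
have [_ _ ay] := nbrs_adj aN; have [_ _ bb'] := nbrs_adj bN.
move: un; rewrite /= !inE !negb_or => un; split_andb.
suff [exE cE] : (forall v, (v \in exits T) = (v \in set0) || (v \notin [set y; b']) && (v \in exits S))
  /\ #|exits T| + #|[set y; b']| = #|(set0 : {set G})| + #|exits S|.
  by split=> //; move: cE; rewrite cards0 cards2 yb'.
step_exits aN bN cN dN.
- entry a.
- entry b.
Qed.

(** The entry forces the tip [a]; once [c] is paid for, [a] forces [d] and [c] forces [b]. This
    covers one and two edges alike. *)
Lemma dia_derives F : derives F S -> derives (c |: F) T.
Proof.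
case: Dabcd abcdS => aN bN cN _ _ [aS _ _ _] dF C clC.
rewrite subUset sub1set => /andP[cC FC]; have SC := dF C clC FC.
have yC := subsetP SC _ yS.
have aC : a \in C.
  by apply: (force_exit clC cS SC yS aS); rewrite adj_sym; case: (nbrs_adj aN).
have dC : d \in C by apply: (force_third clC (nbrsAC aN)).
have bC : b \in C by apply: (force_third clC (nbrsAC cN)).
rewrite subUset SC andbT.
by apply/subsetP=> v; rewrite !inE -!orbA => /or4P[]/eqP->.
Qed.
End DiamondStep.

Ltac nat_lia :=
  intros; repeat match goal with H : is_true (_ <= _) |- _ => move/leP: H => H end;
  try match goal with |- is_true (_ <= _) => apply/leP end; unfold addn, subn, muln in *; lia.

(** * Growing to the whole graph *)

Hypothesis Gconn : connected G.

Lemma no_exits S : S != set0 -> exits S = set0 -> S = setT.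
Proof.
case/set0Pn=> x0 x0S noS; apply/setP=> x; rewrite inE.
have /andP[_ /forallP/(_ x0)/forallP/(_ x)/connectP[r + ->]] := Gconn.
elim: r x0 x0S => //= z r IHr y yS /andP[yz]; apply: IHr.
apply: contraT => zS; have : y \in exits S by apply/exitP; split=> //; exists z.
by rewrite noS inE.
Qed.

Lemma growth_incr S y T : growth S y T -> S \proper T.
Proof.
by case=> [x p q p' q' _ [h _ _]|x p q p' q' _ [h _ _]|x p q p' q' _ [h _ _]|
  x b c d b' _ [h _ _ _]|x b c d b' _ [h _ _ _]] *; apply/properP;
  split; rewrite ?subsetUr //; exists x; rewrite // !inE eqxx.
Qed.

Lemma growth_closed S y T : tri_closed S -> growth S y T -> tri_closed T.
Proof.
by move=> cS; case=> [x p q p' q' h|x p q p' q' h|x p q p' q' h|a b c d b' h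
  |a b c d b' h] *; apply: tri_closedU => //;
  [exact: triangle_closed h|exact: triangle_closed h|exact: triangle_closed h|
   exact: diamond_closed h|exact: diamond_closed h].
Qed.

(** Induction on the number of vertices outside [S]. It is applied to properties saying that
    suitable data on [S] already yield the bound for the whole graph. *)
Lemma exhaust_by_growth (P : {set G} -> Prop) : P setT ->
    (forall S, tri_closed S -> exits S != set0 ->
      (forall y T, y \in exits S -> growth S y T -> P T) -> P S) ->
  forall S, tri_closed S -> S != set0 -> P S.
Proof.
move=> PT step S; have [n] := ubnP #|~: S|.
elim: n S => // n IHn S; rewrite ltnS => leS cS S0.
have [noS|exS] := eqVneq (exits S) set0; first by rewrite (no_exits S0 noS).
apply: step => // y T yS gr; apply: IHn.
- apply: leq_trans leS; apply: proper_card; rewrite properC.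
  exact: growth_incr gr.
- exact: growth_closed gr.
- by apply/set0Pn; exists y; apply: (subsetP (proper_sub (growth_incr gr)) _ (exits_sub yS)).
Qed.

(** * Forcing sets and independent sets carried along the growth *)

Definition good := zero_forcing_number G <= independence_number G.

Definition config S F I := [/\ derives F S, independent I & I \subset S].

Lemma config_good F I : config setT F I -> #|F| <= #|I| -> good.
Proof.
case=> /zero_forcingP /zero_forcing_number_le leF /independence_number_ge leI _ FI.
exact: leq_trans leF (leq_trans FI leI).
Qed.

Lemma config_insert T F I v : config T F I -> v \in T -> v \notin I ->
    (forall u, v -- u -> u \notin I) ->
  config T F (v |: I) /\ #|v |: I| = #|I|.+1.
Proof.
case=> dF iI IT vT vI vNI; split; last by rewrite cardsU1 vI.
split=> //; last by rewrite subUset sub1set vT.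
by apply: independent_add => // u; apply: contraTN; apply: vNI.
Qed.

Lemma config_add S T F F' I v : config S F I -> S \subset T -> derives F' T ->
    v \in T -> v \notin S -> (forall u, v -- u -> u \notin I) ->
  config T F' (v |: I) /\ #|v |: I| = #|I|.+1.
Proof.
case=> _ iI IS ST dF' vT vS vNI; apply: config_insert => //.
  by split=> //; apply: subset_trans IS ST.
exact: contra (subsetP IS v) vS.
Qed.

(* As I keeps away from the exits, it can be extended at any entry of the next unit. *)
Definition full S k := exists F I,
  [/\ config S F I, {in I, forall u, u \notin exits S} & #|F| <= #|I| + k].

(** The deficit |F| - |I| is already at most 0, so [I] is allowed to contain exits: no further gain
    is needed. *)
Definition free S := exists F I, config S F I /\ #|F| <= #|I|.

Lemma notin_exits S I v u : I \subset S -> {in I, forall u, u \notin exits S} ->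
  v \notin S -> v -- u -> u \notin I.
Proof.
move=> IS Iex vS vu; apply/negP=> uI; move: (Iex u uI) => /exitP; apply.
by split; [apply: (subsetP IS)|exists v; rewrite // adj_sym].
Qed.

(** Neighbours in [S] of a vertex outside are exits, which [I] avoids, so [V] and [I] are jointly
    independent. The number [l] bounds the net gain from below; if [k < l], truncation of [k - l]
    only weakens the claim. *)
Lemma full_add S T (V : {set G}) k l :
    full S k -> S \subset T -> V \subset T -> independent V ->
    {in V, forall v, v \notin S /\ v \notin exits T} ->
    {in S, forall u, u \in exits T -> u \in exits S} ->
    (forall F, derives F S -> exists2 F', derives F' T & #|F'| + l <= #|F| + #|V|) ->
  full T (k - l).
Proof.
move=> [F [I [[dF iI IS] Iex FI]]] ST VT iV VS exT cost.
have [F' dF' F'F] := cost F dF; exists F', (V :|: I); split; first split=> //.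
- apply/independentP=> u v /setUP[uV|uI] /setUP[vV|vI].
  + exact: (independentP _ iV).
  + apply/negP=> uv; have := notin_exits IS Iex (proj1 (VS u uV)) uv.
    by rewrite vI.
  + rewrite adj_sym; apply/negP=> uv; have := notin_exits IS Iex (proj1 (VS v vV)) uv.
    by rewrite uI.
  + exact: (independentP _ iI).
- by rewrite subUset VT (subset_trans IS ST).
- move=> u /setUP[/VS[]//|uI]; apply: contra (Iex u uI).
  by apply: exT; apply: (subsetP IS).
- rewrite cardsU (_ : V :&: I = set0) ?cards0 ?subn0; last first.
    apply/setP=> v; rewrite !inE; apply/negP=> /andP[/VS[vS _] /(subsetP IS)].
    exact/negP.
  nat_lia.
Qed.

Lemma cardU1_le (A : {set G}) v : #|v |: A| <= #|A|.+1.
Proof. by rewrite cardsU1; case: (v \in A). Qed.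

Lemma set1_independent v : independent [set v].
Proof. by apply/independentP=> ? ? /set1P-> /set1P->; rewrite adj_irrefl. Qed.

Lemma exits_notin S v : v \notin S -> v \notin exits S.
Proof. by apply: contra; apply: exits_sub. Qed.

Section TriangleFull.
Variables (S : {set G}) (y x p q p' q' : G) (k : nat).
Hypotheses (cS : tri_closed S) (yS : y \in S) (Txpq : triangle x p q y p' q').
Hypotheses (xpqS : [/\ x \notin S, p \notin S & q \notin S]) (fS : full S k).
Local Notation T := ([set x; p; q] :|: S).

(** The outer neighbour of [x] lies in [S], so [x] is no exit of the enlarged set and can join [I],
    which balances the cost of [p]. *)
Lemma tri1_full : p' \notin S -> q' \notin S -> full T k.
Proof.
move=> p'S q'S; have [exE _] := tri1_exits cS yS Txpq xpqS p'S q'S.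
have [xS pS qS] := xpqS; have [xN _ _ _] := Txpq.
rewrite -(subn0 k); apply: (full_add (V := [set x]) fS).
- exact: subsetUr.
- by rewrite sub1set !inE eqxx.
- exact: set1_independent.
- move=> v /set1P->; rewrite exE inE negb_or negb_and exits_notin // orbT andbT.
  by split=> //; rewrite ?inE; have := nbrs_adj xN => -[/adj_neq xp /adj_neq xq _]; negs.
- move=> u uS; rewrite exE !inE => /orP[/orP[]/eqP e|/andP[]//]; subst; contra_mem.
- move=> F dF; exists (p |: F); first exact: (tri1_derives cS yS Txpq xpqS).
  by rewrite addn0 cards1 addn1 cardU1_le.
Qed.

Lemma tri2_full : p' \in S -> q' \notin S -> full T (k - 1).
Proof.
move=> p'S q'S; have [exE _] := tri2_exits cS yS Txpq xpqS p'S q'S.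
have [xS pS qS] := xpqS; have [xN _ _ _] := Txpq.
apply: (full_add (V := [set x]) fS).
- exact: subsetUr.
- by rewrite sub1set !inE eqxx.
- exact: set1_independent.
- move=> v /set1P->; rewrite exE inE negb_or negb_and exits_notin // orbT andbT.
  by split=> //; rewrite ?inE; have := nbrs_adj xN => -[_ /adj_neq xq _]; negs.
- move=> u uS; rewrite exE !inE => /orP[/eqP e|/andP[]//]; subst; contra_mem.
- move=> F dF; exists F; last by rewrite cards1.
  exact: (tri2_derives cS yS Txpq xpqS).
Qed.

Lemma tri3_full : p' \in S -> q' \in S -> full T (k - 1).
Proof.
move=> p'S q'S; have [exE _] := tri3_exits cS yS Txpq xpqS p'S q'S.
have [xS pS qS] := xpqS.
apply: (full_add (V := [set x]) fS).
- exact: subsetUr.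
- by rewrite sub1set !inE eqxx.
- exact: set1_independent.
- by move=> v /set1P->; rewrite exE inE negb_and exits_notin // orbT.
- by move=> u uS; rewrite exE !inE => /andP[].
- move=> F dF; exists F; last by rewrite cards1.
  exact: (tri2_derives cS yS Txpq xpqS).
Qed.
End TriangleFull.

Section DiamondFull.
Variables (S : {set G}) (y a b c d b' : G) (k : nat).
Hypotheses (cS : tri_closed S) (yS : y \in S) (Dabcd : diamond a b c d y b').
Hypothesis abcdS : [/\ a \notin S, b \notin S, c \notin S & d \notin S].
Hypothesis fS : full S k.
Local Notation T := ([set a; b; c; d] :|: S).

(** A central vertex has all its neighbours in the diamond, so it can always join [I] and is never
    an exit. *)
Lemma dia1_full : b' \notin S -> full T k.
Proof.
move=> b'S; have [exE _] := dia1_exits cS yS Dabcd abcdS b'S.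
have [aS bS cS' dS] := abcdS; have [_ _ cN _ _] := Dabcd.
rewrite -(subn0 k); apply: (full_add (V := [set c]) fS).
- exact: subsetUr.
- by rewrite sub1set !inE eqxx ?orbT.
- exact: set1_independent.
- move=> v /set1P->; rewrite exE inE negb_or negb_and exits_notin // orbT andbT.
  by split=> //; rewrite ?inE; have := nbrs_adj cN => -[_ /adj_neq cb _]; negs.
- move=> u uS; rewrite exE !inE => /orP[/eqP e|/andP[]//]; subst; contra_mem.
- move=> F dF; exists (c |: F); first exact: (dia_derives cS yS Dabcd abcdS).
  by rewrite addn0 cards1 addn1 cardU1_le.
Qed.

Lemma dia_tips : ~~ a -- b.
Proof.
have [aN _ _ _ un] := Dabcd; move: un; rewrite /= !inE !negb_or => un; split_andb.
by rewrite aN !inE; negs.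
Qed.

(** Both entry points are exits of [S], hence outside [I], so both tips join [I] at the price of one
    vertex of [F]. *)
Lemma dia2_full : b' \in S -> full T (k - 1).
Proof.
move=> b'S; have [exE _] := dia2_exits cS yS Dabcd abcdS b'S.
have [aS bS cS' dS] := abcdS; have [aN _ _ _ un] := Dabcd.
have ab := dia_tips; apply: (full_add (V := [set a; b]) fS).
- exact: subsetUr.
- by apply/subsetP=> v; rewrite !inE => /orP[]->; rewrite ?orbT.
- rewrite -[[set a; b]]/(a |: [set b]); apply: independent_add.
    exact: set1_independent.
  by move=> u /set1P->.
- by move=> v /set2P[]->; rewrite exE inE negb_and exits_notin // orbT.
- by move=> u uS; rewrite exE !inE => /andP[].
- move=> F dF; exists (c |: F); first exact: (dia_derives cS yS Dabcd abcdS).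
  rewrite cards2; have -> : a != b by move: un; rewrite /= !inE !negb_or => un; split_andb.
  by rewrite addn1 addn2 ltnS cardU1_le.
Qed.
End DiamondFull.

(** Steps without gain do not lower the number of exits; a gain lowers [k] by one (unless it is 0)
    and costs at most three exits. So the inequality persists, and with no exits left it reads 3k <=
    2, that is k = 0. *)
Lemma full_good S k : tri_closed S -> S != set0 -> full S k ->
  3 * k <= #|exits S| + 2 -> good.
Proof.
move=> cS S0; move: k; move: S cS S0.
apply: (exhaust_by_growth (P := fun S => forall k, full S k -> 3 * k <= #|exits S| + 2 -> good)).
  move=> k [F [I [cFI _ FI]]].
  have -> : exits [set: G] = set0.
    by apply/setP=> v; rewrite [RHS]inE; apply/exitP=> -[_ [z]]; rewrite inE.
  rewrite cards0 => k0; apply: (config_good cFI).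
  have e : k = 0 by nat_lia.
  by rewrite e addn0 in FI.
move=> S cS /set0Pn[y yE] IH k fS le; have [T gr] := growth_exists cS yE.
have yS := exits_sub yE; have {}IH := IH y T yE gr; case: gr IH => {T}.
- move=> x p q p' q' h hS p'S q'S /(_ k); apply.
    exact: (tri1_full cS yS h hS fS).
  have [_ e] := tri1_exits cS yS h hS p'S q'S; nat_lia.
- move=> x p q p' q' h hS p'S q'S /(_ (k - 1)); apply.
    exact: (tri2_full cS yS h hS fS).
  have [_ e] := tri2_exits cS yS h hS p'S q'S; nat_lia.
- move=> x p q p' q' h hS p'S q'S /(_ (k - 1)); apply.
    exact: (tri3_full cS yS h hS fS).
  have [_ e] := tri3_exits cS yS h hS p'S q'S; nat_lia.
- move=> a b c d b' h hS b'S /(_ k); apply.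
    exact: (dia1_full cS yS h hS fS).
  have [_ e] := dia1_exits cS yS h hS b'S; nat_lia.
- move=> a b c d b' h hS b'S /(_ (k - 1)); apply.
    exact: (dia2_full cS yS h hS fS).
  have [_ e] := dia2_exits cS yS h hS b'S; nat_lia.
Qed.

Lemma config_notin S F I u : config S F I -> u \notin S -> u \notin I.
Proof. by case=> _ _ IS; apply: contra; apply: (subsetP IS). Qed.

Lemma nbrs_notin v a b c I : nbrs v a b c -> a \notin I -> b \notin I -> c \notin I ->
  forall u, v -- u -> u \notin I.
Proof. by move=> vN aI bI cI u; rewrite vN !inE => /or3P[]/eqP->. Qed.

(** Each unit repays its cost by a vertex with no neighbour in [S]: a triangle vertex or a tip whose
    outer edge avoids [S], or a central vertex when both tips are entered. A triangle reached by
    three edges may have no such vertex, but it costs nothing. *)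
Lemma free_good S : tri_closed S -> S != set0 -> free S -> good.
Proof.
move: S; apply: (exhaust_by_growth (P := fun S => free S -> good)).
  by move=> [F [I [cFI FI]]]; apply: (config_good cFI).
move=> S cS /set0Pn[y yE] IH [F [I [cFI FI]]]; have [T gr] := growth_exists cS yE.
have [dF iI IS] := cFI; have nI u := config_notin (u := u) cFI.
have yS := exits_sub yE; have {}IH := IH y T yE gr; case: gr IH => {T}.
- move=> x p q p' q' h hS p'S q'S; apply; have [xS pS qS] := hS; have [_ pN _ _] := h.
  exists (p |: F), (p |: I).
  have vT : p \in [set x; p; q] :|: S by rewrite !inE eqxx ?orbT.
  have [cT ->] := config_add cFI (subsetUr [set x; p; q] S)
    (tri1_derives cS yS h hS dF) vT pS (nbrs_notin pN (nI _ xS) (nI _ qS) (nI _ p'S)).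
  by split=> //; apply: leq_trans (cardU1_le _ _) _.
- move=> x p q p' q' h hS p'S q'S; apply; have [xS pS qS] := hS; have [_ _ qN _] := h.
  exists F, (q |: I).
  have vT : q \in [set x; p; q] :|: S by rewrite !inE eqxx ?orbT.
  have [cT ->] := config_add cFI (subsetUr [set x; p; q] S)
    (tri2_derives cS yS h hS p'S dF) vT qS (nbrs_notin qN (nI _ xS) (nI _ pS) (nI _ q'S)).
  by split=> //; apply: leqW.
- move=> x p q p' q' h hS p'S q'S; apply; exists F, I; split=> //.
  split=> //; last exact: subset_trans IS (subsetUr _ _).
  exact: (tri2_derives cS yS h hS p'S dF).
- move=> a b c d b' h hS b'S; apply; have [aS bS cS' dS] := hS; have [_ bN _ _ _] := h.
  exists (c |: F), (b |: I).
  have vT : b \in [set a; b; c; d] :|: S by rewrite !inE eqxx ?orbT.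
  have [cT ->] := config_add cFI (subsetUr [set a; b; c; d] S)
    (dia_derives cS yS h hS dF) vT bS (nbrs_notin bN (nI _ cS') (nI _ dS) (nI _ b'S)).
  by split=> //; apply: leq_trans (cardU1_le _ _) _.
- move=> a b c d b' h hS b'S; apply; have [aS bS cS' dS] := hS; have [_ _ cN _ _] := h.
  exists (c |: F), (c |: I).
  have vT : c \in [set a; b; c; d] :|: S by rewrite !inE eqxx ?orbT.
  have [cT ->] := config_add cFI (subsetUr [set a; b; c; d] S)
    (dia_derives cS yS h hS dF) vT cS' (nbrs_notin cN (nI _ aS) (nI _ bS) (nI _ dS)).
  by split=> //; apply: leq_trans (cardU1_le _ _) _.
Qed.

Lemma growth_n0 S y T : growth S y T -> T != set0.
Proof.
move=> gr; apply/set0Pn; have /properP[_ [x xT _]] := growth_incr gr.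
by exists x.
Qed.

(** The deficit is 1 here, against 2 in [full S 2], at the price that [I] may contain exits other
    than [y]. *)
Definition omits S := exists F I y,
  [/\ config S F I, y \in exits S, y \notin I & #|F| <= #|I| + 1].

(* An omitted exit gives a bonus vertex to the last triangle. *)
Lemma omits_good S : tri_closed S -> S != set0 ->
  full S 2 -> omits S -> #|exits S| = 3 -> good.
Proof.
move: S; apply: (exhaust_by_growth (P := fun S => full S 2 -> omits S -> #|exits S| = 3 -> good)).
  by move=> _ [F [I [y [_ /exitP[_ [z]]]]]]; rewrite inE.
move=> S cS _ IH fS [F [I [y [cFI yE yI FI]]]] e3; have [T gr] := growth_exists cS yE.
have [dF iI IS] := cFI; have nI u := config_notin (u := u) cFI.
have cT := growth_closed cS gr; have T0 := growth_n0 gr.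
have yS := exits_sub yE; have {}IH := IH y T yE gr; case: gr cT T0 IH => {T}.
- move=> x p q p' q' h hS p'S q'S cT T0 _.
  apply: (full_good cT T0 (tri1_full cS yS h hS fS p'S q'S)).
  by have [_ ->] := tri1_exits cS yS h hS p'S q'S; rewrite e3.
- move=> x p q p' q' h hS p'S q'S cT T0 _.
  apply: (full_good cT T0 (tri2_full cS yS h hS fS p'S q'S)).
  have [_ e] := tri2_exits cS yS h hS p'S q'S; nat_lia.
- move=> x p q p' q' h hS p'S q'S cT T0 _; have [xS pS qS] := hS; have [xN _ _ _] := h.
  apply: (free_good cT T0); exists F, (x |: I).
  have vT : x \in [set x; p; q] :|: S by rewrite !inE eqxx ?orbT.
  have [? ->] := config_add cFI (subsetUr [set x; p; q] S)
    (tri2_derives cS yS h hS p'S dF) vT xS (nbrs_notin xN (nI _ pS) (nI _ qS) yI).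
  by split=> //; rewrite -addn1.
(* A diamond passes the omission on: its tip [a] can join [I] because [y] is omitted, and the new
   exit [b] is omitted instead. *)
- move=> a b c d b' h hS b'S cT T0; have [aS bS cS' dS] := hS; have [aN _ _ _ un] := h.
  have [exE eT] := dia1_exits cS yS h hS b'S; rewrite eT; apply=> //.
    exact: (dia1_full cS yS h hS fS b'S).
  exists (c |: F), (a |: I), b.
  have vT : a \in [set a; b; c; d] :|: S by rewrite !inE eqxx ?orbT.
  have [cfT ->] := config_add cFI (subsetUr [set a; b; c; d] S)
    (dia_derives cS yS h hS dF) vT aS (nbrs_notin aN (nI _ cS') (nI _ dS) yI).
  split=> //; first by rewrite exE !inE eqxx.
    rewrite !inE negb_or nI // andbT.
    by move: un; rewrite /= !inE !negb_or => un; split_andb; rewrite eq_sym.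
  by have := cardU1_le F c; nat_lia.
- move=> a b c d b' h hS b'S cT T0 _.
  apply: (full_good cT T0 (dia2_full cS yS h hS fS b'S)).
  have [_ e] := dia2_exits cS yS h hS b'S; nat_lia.
Qed.

(* Without a first gain the triangles met so far form a tree, which can be rooted
   at any exit: every other triangle then selects its vertex towards the root. *)
Definition rooted S := exists2 F, derives F S & forall y, y \in exits S ->
  exists I, [/\ independent I, I \subset S, {in I, forall u, u \in exits S -> u = y} &
    #|F| <= #|I| + 2].

Lemma rooted_config S : rooted S -> exists2 F, derives F S & forall y, y \in exits S ->
  exists I, [/\ config S F I, {in I, forall u, u \in exits S -> u = y} & #|F| <= #|I| + 2].
Proof.
by case=> F dF h; exists F => // y /h[I [iI IS Iex FI]]; exists I.
Qed.

Definition diamond_free :=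
  forall a b c d, c -- d -> a -- c -> a -- d -> b -- c -> b -- d -> a = b.

Lemma diamond_freeN a b c d a' b' : diamond_free -> ~ diamond a b c d a' b'.
Proof.
move=> df [aN bN cN dN un]; have [ac ad _] := nbrs_adj aN; have [bc bd _] := nbrs_adj bN.
have [_ _ cd] := nbrs_adj cN; have e := df a b c d cd ac ad bc bd.
by move: un; rewrite /= !inE e eqxx.
Qed.

(** Rooting at [y] keeps the second entry [p'] out of [I], so [p] joins [I] for free. The root stops
    being an exit, which makes the result [full]. Whether [q'] lies in [S] does not matter. *)
Lemma rooted_tri2 S y x p q p' q' : tri_closed S -> y \in exits S ->
  triangle x p q y p' q' -> [/\ x \notin S, p \notin S & q \notin S] -> p' \in S ->
  rooted S -> full ([set x; p; q] :|: S) 1.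
Proof.
move=> cS yE h hS p'S /rooted_config[F dF /(_ y yE)[I [cFI Iex FI]]].
have [xS pS qS] := hS; have [xN pN qN un] := h; have yS := exits_sub yE.
have nI u := config_notin (u := u) cFI; have [_ _ pp'] := nbrs_adj pN.
have p'E : p' \in exits S by apply/exitP; split=> //; exists p; rewrite // adj_sym.
move: un; rewrite /= !inE !negb_or => un; split_andb.
have p'I : p' \notin I.
  have yp' : y != p' by [].
  by apply/negP=> /Iex/(_ p'E) e; rewrite e eqxx in yp'.
exists F, (p |: I).
have vT : p \in [set x; p; q] :|: S by rewrite !inE eqxx ?orbT.
  have [cT ->] := config_add cFI (subsetUr [set x; p; q] S)
    (tri2_derives cS yS h hS p'S dF) vT pS (nbrs_notin pN (nI _ xS) (nI _ qS) p'I).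
split=> //; last nat_lia.
have [q'S|q'S] := boolP (q' \in S).
  have [exE _] := tri3_exits cS yS h hS p'S q'S.
  move=> u /setU1P[->|uI]; rewrite exE in_set0 /=.
    by rewrite negb_and (exits_notin pS) orbT.
  by apply/andP=> -[+ uE]; rewrite (Iex u uI uE) !inE eqxx.
have [exE _] := tri2_exits cS yS h hS p'S q'S.
move=> u /setU1P[->|uI]; rewrite exE in_set1 negb_or negb_and.
  by rewrite (exits_notin pS) orbT andbT.
have [uE|uE] := boolP (u \in exits S).
  by rewrite (Iex u uI uE) !inE eqxx /= andbT; apply: (in_neq yS qS).
by rewrite orbT andbT; apply: contraNneq (nI _ qS) => <-.
Qed.

(** For a new root [p] or [q], add it to the independent set rooted at [y]. For an old root [w]
    other than [y], the set rooted at [w] avoids [y], so [x] can be added. The forcing set is the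
    same for all roots. *)
Lemma rooted_tri1 S y x p q p' q' : tri_closed S -> y \in exits S ->
  triangle x p q y p' q' -> [/\ x \notin S, p \notin S & q \notin S] ->
  p' \notin S -> q' \notin S -> rooted S -> rooted ([set x; p; q] :|: S).
Proof.
move=> cS yE h hS p'S q'S rS; have yS := exits_sub yE.
have [exE _] := tri1_exits cS yS h hS p'S q'S.
have [xS pS qS] := hS; have [xN pN qN _] := h.
have [F dF hF] := rooted_config rS; have dFp := tri1_derives cS yS h hS dF.
exists (p |: F) => // w; rewrite exE.
have [I [cFI Iex FI]] := hF y yE; have nI u := config_notin (u := u) cFI.
have avoid v u : u \in v |: I -> u \in exits ([set x; p; q] :|: S) -> u = v.
  case/setU1P=> // uI; rewrite exE => /orP[/set2P[]e|/andP[+ uE]].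
  - by subst u; move: (nI _ pS); rewrite uI.
  - by subst u; move: (nI _ qS); rewrite uI.
  - by rewrite (Iex u uI uE) inE eqxx.
case/orP=> [/set2P[]->|/andP[wy wE]].
+ have vT : p \in [set x; p; q] :|: S by rewrite !inE eqxx ?orbT.
  have [[_ iJ JT] eJ] := config_add cFI (subsetUr [set x; p; q] S) dFp vT pS
    (nbrs_notin pN (nI _ xS) (nI _ qS) (nI _ p'S)).
  exists (p |: I); split=> // [u uJ|]; first exact: avoid.
  by have := cardU1_le F p; nat_lia.
+ have vT : q \in [set x; p; q] :|: S by rewrite !inE eqxx ?orbT.
  have [[_ iJ JT] eJ] := config_add cFI (subsetUr [set x; p; q] S) dFp vT qS
    (nbrs_notin qN (nI _ xS) (nI _ pS) (nI _ q'S)).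
  exists (q |: I); split=> // [u uJ|]; first exact: avoid.
  by have := cardU1_le F p; nat_lia.
+ have {I cFI Iex FI nI avoid} [I [cFI Iex FI]] := hF w wE.
  have nI u := config_notin (u := u) cFI.
  have yI : y \notin I.
    by apply: contra wy => yI; rewrite in_set1 -(Iex y yI yE).
  have vT : x \in [set x; p; q] :|: S by rewrite !inE eqxx ?orbT.
  have [[_ iJ JT] eJ] := config_add cFI (subsetUr [set x; p; q] S) dFp vT xS
    (nbrs_notin xN (nI _ pS) (nI _ qS) yI).
  exists (x |: I); split=> // [u /setU1P[->|uI]|]; last first.
  * by have := cardU1_le F p; nat_lia.
  * rewrite exE => /orP[/set2P[]e|/andP[_ uE]]; last exact: Iex.
      by subst u; move: (nI _ pS); rewrite uI.
    by subst u; move: (nI _ qS); rewrite uI.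
  * have [/adj_neq xp /adj_neq xq _] := nbrs_adj xN.
    by rewrite exE in_set2 (negPf (exits_notin xS)) andbF orbF; negs.
Qed.

(** The first gain reduces the deficit to 1. Four exits are what a triangle entered by three edges
    requires: one exit is left, and 3 <= 1 + 2 allows [full_good]. *)
Lemma rooted_good S : diamond_free -> tri_closed S -> S != set0 ->
  rooted S -> 4 <= #|exits S| -> good.
Proof.
move=> df; move: S.
apply: (exhaust_by_growth (P := fun S => rooted S -> 4 <= #|exits S| -> good)).
  have -> : exits [set: G] = set0.
    by apply/setP=> v; rewrite [RHS]inE; apply/exitP=> -[_ [z]]; rewrite inE.
  by rewrite cards0.
move=> S cS /set0Pn[y yE] IH rS e4; have [T gr] := growth_exists cS yE.
have cT := growth_closed cS gr; have T0 := growth_n0 gr.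
have yS := exits_sub yE; have {}IH := IH y T yE gr; case: gr cT T0 IH => {T}.
- move=> x p q p' q' h hS p'S q'S cT T0; have [_ ->] := tri1_exits cS yS h hS p'S q'S.
  by apply; [apply: (rooted_tri1 cS yE h hS p'S q'S)|apply: leqW].
- move=> x p q p' q' h hS p'S q'S cT T0 _.
  apply: (full_good cT T0 (rooted_tri2 cS yE h hS p'S rS)).
  have [_ e] := tri2_exits cS yS h hS p'S q'S; nat_lia.
- move=> x p q p' q' h hS p'S q'S cT T0 _.
  apply: (full_good cT T0 (rooted_tri2 cS yE h hS p'S rS)).
  have [_ e] := tri3_exits cS yS h hS p'S q'S; nat_lia.
- by move=> a b c d b' /(diamond_freeN df).
- by move=> a b c d b' /(diamond_freeN df).
Qed.

Lemma outer_eq v a b c u : nbrs v a b c -> v -- u -> u != a -> u != b -> u = c.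
Proof. by move=> vN; rewrite vN !inE => /or3P[]/eqP-> //; rewrite eqxx. Qed.

Definition spare S := exists F I, config S F I /\ #|F| <= #|I| + 1.

(** A triangle met by one edge gives three exits, of which [p] is omitted, so [omits_good] applies.
    With two edges, one exit and deficit 1 suffice for [full_good]. Three edges would need three
    exits. Only diamonds remain. *)
Lemma two_exits S y : tri_closed S -> full S 2 -> spare S -> #|exits S| = 2 ->
    y \in exits S ->
  good \/ exists a b c d b', diamond a b c d y b' /\
    [/\ a \notin S, b \notin S, c \notin S & d \notin S].
Proof.
move=> cS fS [F [I [cFI FI]]] e2 yE; have [T gr] := growth_exists cS yE.
have nI u := config_notin (u := u) cFI; have [dF _ _] := cFI.
have cT := growth_closed cS gr; have T0 := growth_n0 gr.
have yS := exits_sub yE; case: gr cT T0 => {T}.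
- move=> x p q p' q' h hS p'S q'S cT T0; left.
  have [exE eT] := tri1_exits cS yS h hS p'S q'S.
  apply: (omits_good cT T0 (tri1_full cS yS h hS fS p'S q'S)); last by rewrite eT e2.
  have [xS pS qS] := hS; have [_ _ qN _] := h.
  have vT : q \in [set x; p; q] :|: S by rewrite !inE eqxx ?orbT.
  have [cfT eJ] := config_add cFI (subsetUr [set x; p; q] S)
    (tri1_derives cS yS h hS dF) vT qS (nbrs_notin qN (nI _ xS) (nI _ pS) (nI _ q'S)).
  exists (p |: F), (q |: I), p; split=> //; first by rewrite exE in_set2 eqxx.
    rewrite in_setU1 negb_or nI // andbT.
    by case: (nbrs_adj qN) => _ /adj_neq; rewrite eq_sym.
  by have := cardU1_le F p; nat_lia.
- move=> x p q p' q' h hS p'S q'S cT T0; left.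
  apply: (full_good cT T0 (tri2_full cS yS h hS fS p'S q'S)).
  by have [_] := tri2_exits cS yS h hS p'S q'S; rewrite e2 => -[->].
- move=> x p q p' q' h hS p'S q'S _ _.
  by have [_] := tri3_exits cS yS h hS p'S q'S; rewrite e2 addn3.
- by move=> a b c d b' h hS _ _ _; right; exists a, b, c, d, b'.
- by move=> a b c d b' h hS _ _ _; right; exists a, b, c, d, b'.
Qed.

(** * Growth from a diamond *)

Section FirstDiamond.
Variables a b c d a' b' : G.
Hypothesis Dabcd : diamond a b c d a' b'.
Local Notation S := [set a; b; c; d].

Lemma diamond_exits :
  (forall v, (v \in exits S) = (v \in [set a; b])) /\ #|exits S| = 2.
Proof.
move: Dabcd => [aN bN cN dN un].
have [_ _ aa'] := nbrs_adj aN; have [_ _ bb'] := nbrs_adj bN.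
move: un; rewrite /= !inE !negb_or => un; split_andb.
have exE v : (v \in exits S) = (v \in [set a; b]).
  apply/exitP/set2P=> [[+ [z +]]|].
    rewrite !inE -!orbA => /or4P[]/eqP->; try by [left|right];
    by rewrite ?cN ?dN !inE => + /or3P[]/eqP ez; subst z; rewrite eqxx ?orbT.
  case=> ->; rewrite !inE eqxx ?orbT; split=> //.
    by exists a' => //; rewrite !inE; negs.
  by exists b' => //; rewrite !inE; negs.
by split=> //; rewrite (eq_card exE) cards2 (_ : a != b).
Qed.

(** Taking both tips gives deficit 1, but both are exits; [diamond_full] keeps [I] off the exits and
    has deficit 2. *)
Lemma diamond_config : config S [set a; c; d] [set a; b].
Proof.
have [aN bN cN dN un] := Dabcd; split.
- move=> C clC /subsetP FC.
  have [aC cC dC] : [/\ a \in C, c \in C & d \in C] by split; apply: FC; rewrite !inE eqxx ?orbT.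
  have bC := force_third clC (nbrsAC cN) cC aC dC.
  by apply/subsetP=> v; rewrite !inE -!orbA => /or4P[]/eqP->.
- rewrite -[[set a; b]]/(a |: [set b]); apply: independent_add.
    exact: set1_independent.
  by move=> u /set1P->; apply: dia_tips Dabcd.
- by apply/subsetP=> v; rewrite !inE => /orP[]->; rewrite ?orbT.
Qed.

Lemma diamond_full : full S 2.
Proof.
have [dF _ _] := diamond_config; have [aN bN cN dN un] := Dabcd.
move: un; rewrite /= !inE !negb_or => un; split_andb.
exists [set a; c; d], [set c]; split; first split=> //.
- exact: set1_independent.
- by rewrite sub1set !inE eqxx orbT.
- by move=> u /set1P->; have [-> _] := diamond_exits; rewrite !inE; negs.
- by rewrite cards1 card_set3 //; distinct.
Qed.

Lemma diamond_neq : a != b.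
Proof. by have [_ _ _ _] := Dabcd; rewrite /= !inE !negb_or => un; split_andb. Qed.

Lemma diamond_spare : #|[set a; c; d]| <= #|[set a; b]| + 1.
Proof.
have [_ _ _ _] := Dabcd; rewrite /= !inE !negb_or => un; split_andb.
by rewrite cards2 diamond_neq card_set3 //; distinct.
Qed.

Let cS := diamond_closed Dabcd.

Section SecondDiamond.
Variables a1 b1 c1 d1 b1' : G.
Hypothesis D1 : diamond a1 b1 c1 d1 a b1'.
Hypothesis U1 : [/\ a1 \notin S, b1 \notin S, c1 \notin S & d1 \notin S].

Lemma link1 : a' = a1.
Proof.
have [aN _ _ _ _] := Dabcd; have [a1N _ _ _ _] := D1; have [a1S _ _ _] := U1.
apply/esym/(outer_eq aN); first by rewrite adj_sym; case: (nbrs_adj a1N).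
  by apply: contraNneq a1S => ->; rewrite !inE eqxx ?orbT.
by apply: contraNneq a1S => ->; rewrite !inE eqxx ?orbT.
Qed.

Lemma closing_necklace2 : b1' \in S -> exists p : nat -> G, presents N2_table p.
Proof.
move=> b1'S; have aS : a \in S by rewrite !inE eqxx.
have [aN bN cN dN un] := Dabcd; have [a1N b1N c1N d1N un1] := D1.
have [a1S b1S c1S d1S] := U1; have [_ _ b1b] := nbrs_adj b1N.
have eb : b1' = b.
  have : b1' \in exits S.
    by apply/exitP; split=> //; exists b1; rewrite // adj_sym.
  rewrite (proj1 diamond_exits) => /set2P[e|//].
  by have := dia2_entries cS aS D1 U1 b1'S; rewrite e eqxx.
rewrite eb in b1b b1N.
have eb' : b' = b1.
  apply/esym/(outer_eq bN); first by rewrite adj_sym.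
    by apply: contraNneq b1S => ->; rewrite !inE eqxx ?orbT.
  by apply: contraNneq b1S => ->; rewrite !inE eqxx ?orbT.
(* The tips of the second diamond are listed in the order [b1], [a1], since the table joins index 0
   to index 5. *)
have ea' := link1; exists (nth a [:: a; b; c; d; b1; a1; c1; d1]).
rewrite ea' in aN; rewrite eb' in bN; apply: cubic_presents => //.
  move: un un1 a1S b1S c1S d1S; rewrite /= !inE !negb_or => un un1 ? ? ? ?; split_andb.
  distinct.
by rewrite /= !aN !bN !cN !dN !a1N !b1N !c1N !d1N !inE !eqxx !orbT.
Qed.

Hypothesis b1'S : b1' \notin S.
Local Notation S1 := ([set a1; b1; c1; d1] :|: S).

(** The exits are now [b] and [b1], with deficit 1, so [two_exits] at [b1] leaves only a third
    diamond. If its far tip leads out, a gain is possible; otherwise it closes up to N_3. *)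
Lemma second_diamond : good \/ exists p : nat -> G, presents N3_table p.
Proof.
have aS : a \in S by rewrite !inE eqxx.
have [aN bN cN dN un] := Dabcd; have [a1N b1N c1N d1N un1] := D1.
have [a1S b1S c1S d1S] := U1.
have [exE eT] := dia1_exits cS aS D1 U1 b1'S.
have cS1 : tri_closed S1 by apply: tri_closedU cS; apply: diamond_closed D1.
have cf0 := diamond_config; have [dF0 _ _] := cf0.
have nI u := config_notin (u := u) cf0.
have vT : c1 \in S1 by rewrite !inE eqxx ?orbT.
have [cf1 e1] := config_add cf0 (subsetUr [set a1; b1; c1; d1] S)
  (dia_derives cS aS D1 U1 dF0) vT c1S (nbrs_notin c1N (nI _ a1S) (nI _ b1S) (nI _ d1S)).
have F1 := cardU1_le [set a; c; d] c1; have sp0 := diamond_spare.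
have {}nI u := config_notin (u := u) cf1.
have b1E : b1 \in exits S1 by rewrite exE in_set1 eqxx.
have b1S1 := exits_sub b1E.
have b1I : b1 \notin c1 |: [set a; b].
  rewrite in_setU1 negb_or; apply/andP; split.
    by have [_ /adj_neq c1b1 _] := nbrs_adj c1N; rewrite eq_sym.
  by apply: contra b1S; rewrite !inE => /orP[]->; rewrite ?orbT.
case: (@two_exits S1 b1) => //; first exact: (dia1_full cS aS D1 U1 diamond_full b1'S).
- by do 2!eexists; split; [exact: cf1|nat_lia].
- by rewrite eT (proj2 diamond_exits).
- by left.
case=> a2 [b2 [c2 [d2 [b2' [D2 U2]]]]].
have [a2N b2N c2N d2N un2] := D2; have [a2S b2S c2S d2S] := U2.
have [_ _ b2b] := nbrs_adj b2N; have [_ _ a2b] := nbrs_adj a2N.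
have [b2'S|b2'S] := boolP (b2' \in S1); last first.
  (* The exit [b1] is not in the independent set and [b2'] is outside, so both tips [a2] and [b2]
     are gained for the single cost [c2]: the deficit becomes 0. *)
  left; apply: (@free_good ([set a2; b2; c2; d2] :|: S1)).
  - by apply: tri_closedU cS1; apply: diamond_closed D2.
  - by apply/set0Pn; exists a2; rewrite !inE eqxx.
  have [dF1 _ _] := cf1; have dF2 := dia_derives cS1 b1S1 D2 U2 dF1.
  have a2T : a2 \in [set a2; b2; c2; d2] :|: S1 by rewrite !inE eqxx.
  have b2T : b2 \in [set a2; b2; c2; d2] :|: S1 by rewrite !inE eqxx ?orbT.
  have [cf2 e2] := config_add cf1 (subsetUr _ S1) dF2 a2T a2S
    (nbrs_notin a2N (nI _ c2S) (nI _ d2S) b1I).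
  move: un2; rewrite /= !inE !negb_or => un2; split_andb.
  have nI2 u : u \notin S1 -> u != a2 -> u \notin a2 |: (c1 |: [set a; b]).
    by move=> uS ua2; rewrite in_setU1 negb_or ua2 nI.
  have [ba ca da] : [/\ b2 != a2, c2 != a2 & d2 != a2] by split; rewrite eq_sym.
  have ba' : b2' != a2 by rewrite eq_sym.
  have [cf3 e3] := config_insert cf2 b2T (nI2 _ b2S ba)
    (nbrs_notin b2N (nI2 _ c2S ca) (nI2 _ d2S da) (nI2 _ b2'S ba')).
  do 2!eexists; split; first exact: cf3.
  by have := cardU1_le (c1 |: [set a; c; d]) c2; nat_lia.
(* The far tip must return to the other exit, which is [b]. *)
right; have eb : b2' = b.
  have : b2' \in exits S1.
    by apply/exitP; split=> //; exists b2; rewrite // adj_sym.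
  rewrite exE in_set1 => /orP[/eqP e|/andP[b2'a]].
    by have := dia2_entries cS1 b1S1 D2 U2 b2'S; rewrite e eqxx.
  rewrite (proj1 diamond_exits) => /set2P[e|//].
  by rewrite e in_set1 eqxx in b2'a.
rewrite eb in b2b b2N.
have eb' : b' = b2.
  apply/esym/(outer_eq bN); first by rewrite adj_sym.
    by apply: contraNneq b2S => ->; rewrite !inE eqxx ?orbT.
  by apply: contraNneq b2S => ->; rewrite !inE eqxx ?orbT.
have eb1' : b1' = a2.
  apply/esym/(outer_eq b1N); first by rewrite adj_sym.
    by apply: contraNneq a2S => ->; rewrite !inE eqxx ?orbT.
  by apply: contraNneq a2S => ->; rewrite !inE eqxx ?orbT.
have ea' := link1; exists (nth a [:: a; b; c; d; b1; a1; c1; d1; b2; a2; c2; d2]).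
rewrite ea' in aN; rewrite eb' in bN; rewrite eb1' in b1N; apply: cubic_presents => //.
  move: un un1 un2 a1S b1S c1S d1S a2S b2S c2S d2S.
  rewrite /= !inE !negb_or => un un1 un2 ? ? ? ? ? ? ? ?; split_andb.
  distinct.
by rewrite /= !aN !bN !cN !dN !a1N !b1N !c1N !d1N !a2N !b2N !c2N !d2N !inE !eqxx !orbT.
Qed.
End SecondDiamond.

Lemma first_diamond : [\/ good, exists p : nat -> G, presents N2_table p |
  exists p : nat -> G, presents N3_table p].
Proof.
case: (@two_exits S a cS diamond_full).
- by do 2!eexists; split; [exact: diamond_config|exact: diamond_spare].
- exact: (proj2 diamond_exits).
- by rewrite (proj1 diamond_exits) in_set2 eqxx.
- by constructor 1.
case=> a1 [b1 [c1 [d1 [b1' [D1 U1]]]]].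
have [b1'S|b1'S] := boolP (b1' \in S).
  by constructor 2; apply: closing_necklace2 D1 U1 b1'S.
by case: (second_diamond D1 U1 b1'S) => ?; [constructor 1|constructor 3].
Qed.
End FirstDiamond.

(** * Growth from a triangle in the absence of diamonds *)

Section FirstTriangle.
Variables l1 l2 l3 l1' l2' l3' : G.
Hypotheses (Gdf : diamond_free) (TL : triangle l1 l2 l3 l1' l2' l3').
Local Notation S := [set l1; l2; l3].

Lemma triangle_start_exits : (forall v, (v \in exits S) = (v \in S)).
Proof.
move: TL => [l1N l2N l3N un].
have [_ _ e1] := nbrs_adj l1N; have [_ _ e2] := nbrs_adj l2N.
have [_ _ e3] := nbrs_adj l3N.
move: un; rewrite /= !inE !negb_or => un; split_andb.
move=> v; apply/idP/idP; first exact: exits_sub.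
move=> vS; apply/exitP; split=> //; move: vS; rewrite !inE -orbA => /or3P[]/eqP->.
- by exists l1' => //; rewrite !inE; negs.
- by exists l2' => //; rewrite !inE; negs.
- by exists l3' => //; rewrite !inE; negs.
Qed.

Lemma triangle_start_rooted : rooted S.
Proof.
have un : #|S| = 3.
  have [_ _ _] := TL; rewrite /= !inE !negb_or => un; split_andb.
  by rewrite card_set3 //; distinct.
exists S => [C _ //|y yE]; exists [set y]; split.
- exact: set1_independent.
- by rewrite sub1set -triangle_start_exits.
- by move=> u /set1P.
- by rewrite cards1 un.
Qed.

(** One further triangle decides: entered by one edge it leaves four exits, as [rooted_good]
    requires; by two edges, two exits and deficit 1; by three edges the graph closes up as the
    prism. *)
Lemma first_triangle : good \/ exists p : nat -> G, presents prism_table p.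
Proof.
have cS := triangle_closed TL; have l1S : l1 \in S by rewrite !inE eqxx.
have l1E : l1 \in exits S by rewrite triangle_start_exits.
have e3 : #|exits S| = 3.
  rewrite (eq_card triangle_start_exits).
  have [_ _ _] := TL; rewrite /= !inE !negb_or => un; split_andb.
  by rewrite card_set3 //; distinct.
have rS := triangle_start_rooted; have [T gr] := growth_exists cS l1E.
have cT := growth_closed cS gr; have T0 := growth_n0 gr; case: gr cT T0 => {T}.
- move=> x p q p' q' h hS p'S q'S cT T0; left.
  apply: (rooted_good Gdf cT T0 (rooted_tri1 cS l1E h hS p'S q'S rS)).
  by have [_ ->] := tri1_exits cS l1S h hS p'S q'S; rewrite e3.
- move=> x p q p' q' h hS p'S q'S cT T0; left.
  apply: (full_good cT T0 (rooted_tri2 cS l1E h hS p'S rS)).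
  by have [_] := tri2_exits cS l1S h hS p'S q'S; rewrite e3 => -[->].
- move=> x p q p' q' [xN pN qN un'] [xS pS qS] p'S q'S _ _; right.
  have [l1N l2N l3N un] := TL.
  have outer l m r s v : nbrs l m r s -> v \notin S -> m \in S -> r \in S -> v -- l -> s = v.
    move=> lN vS mS rrS vl; apply/esym/(outer_eq lN); first by rewrite adj_sym.
      by rewrite eq_sym (in_neq mS vS).
    by rewrite eq_sym (in_neq rrS vS).
  have [_ _ xl1] := nbrs_adj xN; have [_ _ pp'] := nbrs_adj pN.
  have [_ _ qq'] := nbrs_adj qN.
  have l2S : l2 \in S by rewrite !inE eqxx ?orbT.
  have l3S : l3 \in S by rewrite !inE eqxx ?orbT.
  have eX := outer _ _ _ _ _ l1N xS l2S l3S xl1; rewrite eX in l1N.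
  have un6 : uniq [:: l1; l2; l3; x; p; q].
    move: xS pS qS un un'; rewrite /= !inE !negb_or => ? ? ? un un'; split_andb.
    distinct.
  have [yp' yq' p'q'] : [/\ l1 != p', l1 != q' & p' != q'].
    by move: un'; rewrite /= !inE !negb_or => un'; split_andb.
  (* The outer neighbours of [p] and [q] are [l2] and [l3] in some order; the order decides how [p]
     and [q] are listed below. *)
  have [[ep eq]|[ep eq]] : p' = l2 /\ q' = l3 \/ p' = l3 /\ q' = l2.
    move: p'S q'S; rewrite !inE -!orbA (eq_sym p') (eq_sym q') (negPf yp') (negPf yq') /=.
    case/orP=> /eqP ep /orP[]/eqP eq; try by [left|right].
    - by rewrite ep eq eqxx in p'q'.
    - by rewrite ep eq eqxx in p'q'.
  + rewrite ep in pN pp'; rewrite eq in qN qq'.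
    have e2 := outer _ _ _ _ _ l2N pS l1S l3S pp'; rewrite e2 in l2N.
    have e3' := outer _ _ _ _ _ l3N qS l1S l2S qq'; rewrite e3' in l3N.
    exists (nth l1 [:: l1; l2; l3; x; p; q]); apply: cubic_presents => //.
    by rewrite /= !l1N !l2N !l3N !xN !pN !qN !inE !eqxx !orbT.
  + rewrite ep in pN pp'; rewrite eq in qN qq'.
    have e2 := outer _ _ _ _ _ l2N qS l1S l3S qq'; rewrite e2 in l2N.
    have e3' := outer _ _ _ _ _ l3N pS l1S l2S pp'; rewrite e3' in l3N.
    exists (nth l1 [:: l1; l2; l3; x; q; p]); apply: cubic_presents => //.
      by move: un6; rewrite /= !inE !negb_or => un6; split_andb; distinct.
    by rewrite /= !l1N !l2N !l3N !xN !pN !qN !inE !eqxx !orbT.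
- by move=> a b c d b' /(diamond_freeN Gdf).
- by move=> a b c d b' /(diamond_freeN Gdf).
Qed.
End FirstTriangle.

(** * Finding a first unit *)

Lemma find_triangle : diamond_free -> exists l1 l2 l3 l1' l2' l3',
  triangle l1 l2 l3 l1' l2' l3'.
Proof.
move=> df; have /andP[/card_gt0P[x _] _] := Gconn.
have [u ux] : exists u, x -- u.
  have : 0 < #|[set u | x -- u]| by rewrite (eqP (forallP Gcubic x)).
  by case/card_gt0P=> u; rewrite inE; exists u.
have [v [w xN]] := nbrs1 ux.
have [p [q [xp xq pq]]] : exists p q, [/\ x -- p, x -- q & p -- q].
  have [xu xv xw] := nbrs_adj xN.
  by case/or3P: (nbrs_claw xN) => e; [exists u, v|exists u, w|exists v, w].
have [px qx qp] : [/\ p -- x, q -- x & q -- p] by rewrite ![p -- x]adj_sym ![q -- _]adj_sym.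
have [x' {}xN] := nbrs2 xp xq (adj_neq pq).
have [p' pN] := nbrs2 px pq (adj_neq xq).
have [q' qN] := nbrs2 qx qp (adj_neq xp).
exists x, p, q, x', p', q'; split=> //.
have [_ _ xx'] := nbrs_adj xN; have [_ _ pp'] := nbrs_adj pN.
have [_ _ qq'] := nbrs_adj qN.
have nxx' := adj_neq xx'; have npp' := adj_neq pp'; have nqq' := adj_neq qq'.
move: (nbrs_uniq xN) (nbrs_uniq pN) (nbrs_uniq qN).
rewrite /= !inE !negb_or => ux1 up1 uq1; split_andb.
(* Were two outer neighbours equal, they would form a second triangle on an edge of the first,
   contrary to [diamond_free]. *)
have x'p' : x' != p'.
  apply/eqP=> e; have qx' : q != x' by [].
  by rewrite (df q x' x p) ?eqxx // adj_sym // e in qx'.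
have x'q' : x' != q'.
  apply/eqP=> e; have px' : p != x' by [].
  by rewrite (df p x' x q) ?eqxx // adj_sym // e in px'.
have p'q' : p' != q'.
  apply/eqP=> e; have xp' : x != p' by [].
  by rewrite (df x p' p q) ?eqxx // adj_sym // e in xp'.
distinct.
Qed.

(** Two triangles on a common edge span a K_4, which is then the whole graph, if [a -- b]; otherwise
    they form a diamond. *)
Lemma find_diamond a b c d :
    c -- d -> a -- c -> a -- d -> b -- c -> b -- d -> a != b ->
  (exists p : nat -> G, presents K4_table p) \/ exists a' b', diamond a b c d a' b'.
Proof.
move=> cd ac ad bc bd nab.
have [ca cb da db] : [/\ c -- a, c -- b, d -- a & d -- b].
  by rewrite ![c -- _]adj_sym ![d -- _]adj_sym.
have dc : d -- c by rewrite adj_sym.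
have [nac nad nbc nbd] : [/\ a != c, a != d, b != c & b != d] by split; apply: adj_neq.
have ncd := adj_neq cd.
have cN : nbrs c a b d by apply: nbrs3 => //; distinct.
have dN : nbrs d a b c by apply: nbrs3 => //; distinct.
have [ab|ab] := boolP (a -- b).
  have ba : b -- a by rewrite adj_sym.
  left; exists (nth a [:: a; b; c; d]); apply: cubic_presents => //; first distinct.
  by rewrite /= ab ac ad ba bc bd ca cb cd da db dc.
right; have [a' aN] := nbrs2 ac ad ncd; have [b' bN] := nbrs2 bc bd ncd.
exists a', b'; split=> //.
have [_ _ aa'] := nbrs_adj aN; have [_ _ bb'] := nbrs_adj bN.
have naa' := adj_neq aa'; have nbb' := adj_neq bb'.
have nba' : b != a' by apply: contraNneq ab => ->.
have nab' : a != b' by apply: contraNneq ab => ->; rewrite adj_sym.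
move: (nbrs_uniq aN) (nbrs_uniq bN); rewrite /= !inE !negb_or => ua ub; split_andb.
by apply/andP; split; distinct.
Qed.

Lemma cubic_claw_free_classification :
  [\/ good, exists p : nat -> G, presents K4_table p,
      exists p : nat -> G, presents prism_table p |
      (exists p : nat -> G, presents N2_table p) \/
      (exists p : nat -> G, presents N3_table p)].
Proof.
pose has_diamond := [exists a : G, exists b : G, exists c : G, exists d : G,
  [&& c -- d, a -- c, a -- d, b -- c, b -- d & a != b]].
have [|no] := boolP has_diamond.
  case/existsP=> a /existsP[b /existsP[c /existsP[d]]].
  case/and5P=> cd ac ad bc /andP[bd ab].
  have [K4|[a' [b' D]]] := find_diamond cd ac ad bc bd ab; first by constructor 2.
  case: (first_diamond D) => ?; first by constructor 1.
    by constructor 4; left.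
  by constructor 4; right.
have df : diamond_free.
  move=> a b c d cd ac ad bc bd; apply/eqP; apply: contraNT no => ab.
  apply/existsP; exists a; apply/existsP; exists b; apply/existsP; exists c.
  by apply/existsP; exists d; rewrite cd ac ad bc bd.
have [l1 [l2 [l3 [l1' [l2' [l3' TL]]]]]] := find_triangle df.
by case: (first_triangle df TL) => ?; [constructor 1|constructor 3].
Qed.
End Structure.

Theorem mainTheorem1 (G : sgraph)
    (Gconn : connected G) (Gcubic : cubic G) (Gclaw : claw_free G) :
  zero_forcing_number G = independence_number G + 1 <->
  isomorphic G prism \/
  isomorphic G (diamond_necklace 2) \/
  isomorphic G (diamond_necklace 3).
Proof.
have [q1 P1] := prism_presents; have [q2 P2] := N2_presents; have [q3 P3] := N3_presents.
split=> [ZA|].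
  case: (cubic_claw_free_classification Gcubic Gclaw Gconn)
    => [|[p pG]|[p pG]|[[p pG]|[p pG]]].
  - by rewrite /good ZA addn1 ltnn.
  (* K_4 has forcing number 3 and independence number 1, so the equality fails. *)
  - by have [Z A] := K4_numbers pG; rewrite Z A in ZA.
  - by left; apply: presents_isomorphic pG P1.
  - by right; left; apply: presents_isomorphic pG P2.
  - by right; right; apply: presents_isomorphic pG P3.
case=> [iso|[iso|iso]].
- by have [p pG] := isomorphic_presents iso P1; have [-> ->] := prism_numbers pG.
- by have [p pG] := isomorphic_presents iso P2; have [-> ->] := N2_numbers pG.
- by have [p pG] := isomorphic_presents iso P3; have [-> ->] := N3_numbers pG.
Qed.
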